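(* Let $P\subset\mathbb{R}^2$ be the moment polytope of a toric surface, let $u$ be a symplectic potential on $P$, $G=\mathrm{Hess}(u)$, and let $\xi=G^{-1}\Phi G^{-1}$ for a symmetric matrix-valued function $\Phi\in C^\infty(P,\mathbb{C}^{2\times2})$. Then $\xi$ is a solution to the complex moment map equation $(\xi^{ab})_{,ab}=0$ if and only if $\Phi$ is orthogonal to the space $\{\mathrm{Hess}(f): f\in C^\infty(P)\}$ with respect to the $L^2$ product on matrix-valued functions on $P$ defined by $G$. In particular, if $G$ and $\xi$ solve the toric HcscK system $$\begin{cases}\left(\xi^{ab}\right)_{,ab}=0\\ \left(\left(1-\xi\,G\,\bar{\xi}\,G\right)^{\frac{1}{2}}G^{-1}\right)^{ab}_{,ab}=-C,\end{cases}$$ then $\xi$ is integrable if and only if it is identically $0$.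
   Context: $P=\{\boldsymbol y\in\mathbb{R}^2:\ell^r(\boldsymbol y)\ge0\ \forall r\}$ is a (compact) Delzant polytope with defining affine-linear functions $\ell^r$, and $P^\circ$ is its interior. A symplectic potential is a function $u=u_P+h$, where $u_P=\sum_r\ell^r\log\ell^r$ and $h$ is smooth on the whole of $P$, such that $\mathrm{Hess}(u)$ is positive definite on $P^\circ$ and $\det\mathrm{Hess}(u)=\big(\delta(\boldsymbol y)\prod_r\ell^r(\boldsymbol y)\big)^{-1}$ for a strictly positive $\delta\in C^0(P)$ (Guillemin's boundary conditions; then $G^{-1}$ extends to $P$). First-order deformations of the complex structure defined by $u$ correspond to matrices $\xi=G^{-1}\Phi G^{-1}$ with $\Phi$ symmetric and smooth on $P$; the deformation is integrable if and only if $\Phi=G\xi G$ is the Hessian of a (complex-valued) function in $C^\infty(P)$. The $L^2$ product defined by $G$ is $\langle\Phi,\Psi\rangle=\int_P\mathrm{Tr}(G^{-1}\Phi\,G^{-1}\bar\Psi)\,\mathrm{d}\mu$, $\mathrm{d}\mu$ Lebesgue measure. $C=4\hat S$ is the topological constant ($\hat S$ the average scalar curvature). Commas denote derivatives in $\boldsymbol y$; the system presupposes that the eigenvalues of $\xi G\bar\xi G$ are less than $1$. *)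

(* Defs.v *)
From HB Require Import structures.
From mathcomp Require Import all_boot all_order all_algebra.
From mathcomp Require Import all_classical all_reals all_analysis.
From mathcomp.real_closed Require Export complex.
Set Implicit Arguments.
Unset Strict Implicit.
Unset Printing Implicit Defensive.
Import Order.TTheory GRing.Theory Num.Theory.
Import numFieldNormedType.Exports.
Local Open Scope classical_set_scope.
Local Open Scope complex_scope.
Local Open Scope ring_scope.

Section Calculus.
Variable R : realType.
Implicit Types (P U : set (R * R)) (f g : R * R -> R) (F : R * R -> R[i]).

Definition basis_vec (a : 'I_2) : R * R := if a == 0 then (1, 0) else (0, 1).

Definition pderiv (a : 'I_2) f : R * R -> R :=
  fun y => 'D_(basis_vec a) f y.

Definition hess f (y : R * R) : 'M[R]_2 :=
  \matrix_(a, b) pderiv b (pderiv a f) y.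

(* M^{ab}_{,ab}, summed over a and b *)
Definition divdiv (M : R * R -> 'M[R]_2) (y : R * R) : R :=
  \sum_a \sum_b pderiv b (pderiv a (fun z => M z a b)) y.

Fixpoint Ck_on (k : nat) U f : Prop :=
  match k with
  | 0%N => {in U, continuous f}
  | k'.+1 => forall a : 'I_2,
      (forall y, U y -> derivable f y (basis_vec a)) /\ Ck_on k' U (pderiv a f)
  end.

(* C^infty(U), for U open *)
Definition smooth_on_open U f : Prop := forall k, Ck_on k U f.

(* f belongs to C^infty(P) for a closed set P: f extends from P to a smooth
   function on an open neighbourhood of P. The values of f off P are
   irrelevant. *)
Definition smooth_on P f : Prop :=
  exists U g, [/\ open U, P `<=` U, smooth_on_open U g
                & forall y, P y -> f y = g y].

Definition csmooth_on P F : Prop :=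
  smooth_on P (fun y => complex.Re (F y)) /\
  smooth_on P (fun y => complex.Im (F y)).

Definition chess F (y : R * R) : 'M[R[i]]_2 :=
  \matrix_(a, b) (hess (fun z => complex.Re (F z)) y a b
               +i* hess (fun z => complex.Im (F z)) y a b).

Definition cdivdiv (M : R * R -> 'M[R[i]]_2) (y : R * R) : R[i] :=
  divdiv (fun z => map_mx (@complex.Re R) (M z)) y
    +i* divdiv (fun z => map_mx (@complex.Im R) (M z)) y.

Definition leb2 := (@lebesgue_measure R \x @lebesgue_measure R)%E.

Definition cintegral (D : set (R * R)) F : R[i] :=
  (\int[leb2]_(y in D) complex.Re (F y))
    +i* (\int[leb2]_(y in D) complex.Im (F y)).

Definition mxC (M : 'M[R]_2) : 'M[R[i]]_2 := map_mx (real_complex R) M.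

Definition posdef (M : 'M[R]_2) : Prop :=
  forall v : 'cV[R]_2, v != 0 -> 0 < (v^T *m M *m v) 0 0.

(* The principal square root: the square root whose spectrum lies in the open
   right half-plane. It exists and is unique when M has no eigenvalue in
   ]-oo, 0]; otherwise this returns 0 if there is none. *)
Definition mxsqrt (M : 'M[R[i]]_2) : 'M[R[i]]_2 :=
  xget 0 [set S : 'M[R[i]]_2 | S *m S = M /\
            forall a : R[i], eigenvalue S a -> 0 < complex.Re a].

End Calculus.

Section Polytope.
Variables (R : realType) (N : nat).
Variables (nu : 'I_N -> int * int) (c : 'I_N -> R).

Definition ell (r : 'I_N) (y : R * R) : R :=
  (nu r).1%:~R * y.1 + (nu r).2%:~R * y.2 + c r.

Definition polytope : set (R * R) := [set y | forall r, 0 <= ell r y].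

Definition vertex (p : R * R) : Prop :=
  polytope p /\
  forall x z, polytope x -> polytope z -> p = 2^-1 *: (x + z) -> x = z.

(* P is compact with nonempty interior, each ell r defines a facet (some point
   of P lies on the line ell r = 0 and on no other), the conormals are
   primitive, and at every vertex exactly two facets meet, with conormals
   forming a basis of Z^2. *)
Definition delzant : Prop :=
  [/\ compact polytope,
      polytope° !=set0,
      forall r, exists2 y, ell r y = 0 & forall s, s != r -> 0 < ell s y,
      forall r, coprimez (nu r).1 (nu r).2
    & forall p, vertex p -> exists r s,
        [/\ r != s,
            forall t, ell t p = 0 <-> (t = r \/ t = s)
          & `|(nu r).1 * (nu s).2 - (nu r).2 * (nu s).1| = 1 ]].

(* 0 log 0 = 0, as ln vanishes at 0 by convention *)
Definition guillemin_potential (y : R * R) : R :=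
  \sum_r ell r y * ln (ell r y).

Definition symplectic_potential (u : R * R -> R) : Prop :=
  [/\ exists2 h, smooth_on polytope h &
        forall y, polytope y -> u y = guillemin_potential y + h y,
      forall y, polytope° y -> posdef (hess u y)
    & exists delta : R * R -> R,
        [/\ {within polytope, continuous delta},
            forall y, polytope y -> 0 < delta y
          & forall y, polytope° y ->
              \det (hess u y) = (delta y * \prod_r ell r y)^-1]].

End Polytope.

(* G and xi are given by formulas only on the interior of P (G blows up along
   the boundary, which is Lebesgue-null), so that equations are imposed and
   integrals taken on P°. *)
Section HcscK.
Variables (R : realType) (P : set (R * R)).
Implicit Types (G : R * R -> 'M[R]_2) (xi Phi Psi : R * R -> 'M[R[i]]_2).

Definition conjmx2 (M : 'M[R[i]]_2) : 'M[R[i]]_2 := map_mx (@conjc R) M.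

Definition xi_of G Phi : R * R -> 'M[R[i]]_2 :=
  fun y => mxC (invmx (G y)) *m Phi y *m mxC (invmx (G y)).

Definition l2prod G Phi Psi : R[i] :=
  cintegral P° (fun y => \tr (mxC (invmx (G y)) *m Phi y
                               *m mxC (invmx (G y)) *m conjmx2 (Psi y))).

Definition complex_moment_map_eq xi : Prop :=
  forall y, P° y -> cdivdiv xi y = 0.

(* Abreu's formula, normalised so that the system with xi = 0 is the constant
   scalar curvature equation for C = 4 * (average scalar curvature). *)
Definition scal G (y : R * R) : R :=
  - (divdiv (fun z => invmx (G z)) y) / 4.

(* The push-forward to P of the Riemannian volume is a constant multiple of
   the Lebesgue measure. *)
Definition avg_scal G : R :=
  (\int[@leb2 R]_(y in P°) scal G y) / (\int[@leb2 R]_(y in P°) 1).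

Definition topC G : R := 4 * avg_scal G.

Definition xiGxiG G xi (y : R * R) : 'M[R[i]]_2 :=
  xi y *m mxC (G y) *m conjmx2 (xi y) *m mxC (G y).

Definition HcscK G xi : Prop :=
  [/\ forall y, P° y -> forall a : R[i], eigenvalue (xiGxiG G xi y) a -> a < 1,
      complex_moment_map_eq xi
    & forall y, P° y ->
        cdivdiv (fun z => mxsqrt (1%:M - xiGxiG G xi z) *m mxC (invmx (G z))) y
        = (- topC G)%:C].

(* The usual criterion for the deformation of the complex structure defined by
   xi to be integrable: Phi = G xi G is a Hessian. *)
Definition integrable_deformation G xi : Prop :=
  exists2 f : R * R -> R[i], csmooth_on P f &
    forall y, P° y -> mxC (G y) *m xi y *m mxC (G y) = chess f y.

End HcscK.

(* Main.v *)
Require Import Defs.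
From mathcomp Require Import all_boot all_order all_algebra.
From mathcomp Require Import all_classical all_reals all_analysis.
From mathcomp Require Import measurable_realfun ring lra.
Import Order.TTheory GRing.Theory Num.Theory.
Import numFieldNormedType.Exports.
Local Open Scope classical_set_scope.
Local Open Scope ring_scope.
Set Implicit Arguments.
Unset Strict Implicit.
Unset Printing Implicit Defensive.

(* With H = G^-1 = K / D, where K = (prod_r l^r) adj G and D = (prod_r l^r) det G,
   all the denominators l^r cancel: K and D are smooth near P, and Guillemin's
   condition D * delta = 1 on the interior keeps D away from 0 on P. Moreover
   H nu_r = l^r k_r with k_r smooth, so that for xi = H Phi H the vector field
   X^a = xi^{ab} f_{,b} - f (xi^{ab})_{,b} is tangent to the boundary:
   X . nu_r = l^r g_r with g_r smooth. The divergence theorem then gives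
   int_P Tr(H Phi H Hess f) = int_P f (xi^{ab})_{,ab} for every f smooth on P.
   One implication follows at once; for the other, take f = (xi^{ab})_{,ab},
   which is itself smooth on P. If moreover Phi = Hess f, then Phi is orthogonal
   to itself, and Phi = 0 because the real and imaginary parts of Phi each
   contribute a nonnegative trace Tr(H A H A).

   The divergence theorem for a tangent field X is obtained without boundary
   integrals: chi = p / (p + e) with p = prod_r l^r vanishes on the boundary, so
   Fubini and the fundamental theorem of calculus on segments give
   int_P div (chi X) = 0; tangency makes X . grad p divisible by p, hence
   X . grad chi stays bounded and tends to 0 pointwise as e -> 0. *)

(** * Smooth functions on open subsets of the plane *)

Section Smooth.
Variable R : realType.
Implicit Types (U : set (R * R)) (f g : R * R -> R).

Lemma pderiv_near (a : 'I_2) U f g y : open U -> U y ->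
  (forall z, U z -> f z = g z) -> pderiv a f y = pderiv a g y.
Proof.
move=> oU Uy fg; apply: near_eq_derive; near=> z; apply: fg.
by near: z; exact: open_nbhs_nbhs.
Unshelve. all: by end_near. Qed.

Lemma derivable_near (v : R * R) U f g y : open U -> U y ->
  (forall z, U z -> f z = g z) -> derivable f y v -> derivable g y v.
Proof.
move=> oU Uy fg; apply: near_eq_derivable; near=> z; apply: fg.
by near: z; exact: open_nbhs_nbhs.
Unshelve. all: by end_near. Qed.

Lemma continuous_near U f g y : open U -> U y ->
  (forall z, U z -> f z = g z) -> {for y, continuous f} -> {for y, continuous g}.
Proof.
move=> oU Uy fg fc; have nU : nbhs y U by exact: open_nbhs_nbhs.
rewrite /prop_for /continuous_at -fg//.
apply: cvg_trans fc; apply: near_eq_cvg; near=> z; apply: fg.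
by near: z; exact: nU.
Unshelve. all: by end_near. Qed.

Lemma Ck_on_ext k U f g : open U -> (forall y, U y -> f y = g y) ->
  Ck_on k U f -> Ck_on k U g.
Proof.
move=> oU; elim: k f g => [|k IH] f g fg /=.
  move=> cf y; rewrite inE => Uy; apply: (continuous_near oU Uy fg).
  by apply: cf; rewrite inE.
move=> Cf a; have [df Ckf] := Cf a; split.
  by move=> y Uy; apply: (derivable_near oU Uy fg); exact: df.
by apply: IH Ckf => y Uy; exact: (pderiv_near a oU Uy fg).
Qed.

Lemma smooth_ext U f g : open U -> (forall y, U y -> f y = g y) ->
  smooth_on_open U f -> smooth_on_open U g.
Proof. by move=> oU fg sf k; apply: (Ck_on_ext oU fg). Qed.

Lemma smooth_continuous U f y : smooth_on_open U f -> U y ->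
  {for y, continuous f}.
Proof. by move=> sf Uy; apply: (sf 0%N); rewrite inE. Qed.

Lemma smooth_derivable (a : 'I_2) U f y : smooth_on_open U f -> U y ->
  derivable f y (basis_vec R a).
Proof. by move=> sf Uy; exact: (sf 1%N a).1. Qed.

Lemma smooth_pderiv U f a : smooth_on_open U f -> smooth_on_open U (pderiv a f).
Proof. by move=> sf k; exact: (sf k.+1 a).2. Qed.

Lemma smooth_subset U V f : V `<=` U -> smooth_on_open U f -> smooth_on_open V f.
Proof.
move=> VU sf k; elim: k f sf => [|k IH] f sf /=.
  move=> y; rewrite inE => /VU Uy; exact: (smooth_continuous sf Uy).
move=> a; split; last exact/IH/smooth_pderiv.
by move=> y /VU Uy; exact: (smooth_derivable sf Uy).
Qed.

(* To prove that a function is smooth, it suffices to put it in a class of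
   functions that is closed under partial derivatives on U. *)
Lemma smooth_coind U (S : (R * R -> R) -> Prop) : open U ->
  (forall f, S f -> [/\ forall y, U y -> {for y, continuous f},
     forall a y, U y -> derivable f y (basis_vec R a) &
     forall a, exists2 g, S g & forall y, U y -> pderiv a f y = g y]) ->
  forall f, S f -> smooth_on_open U f.
Proof.
move=> oU HS f Sf k; elim: k f Sf => [|k IH] f /HS[cf df pf] /=.
  by move=> y; rewrite inE; exact: cf.
move=> a; split; first exact: df.
have [g Sg fg] := pf a.
by apply: (@Ck_on_ext _ _ g) => //; [move=> y Uy; rewrite fg|exact: IH].
Qed.

Lemma is_derive_proj1 (y v : R * R) : is_derive y v (@fst R R : R * R -> R) v.1.
Proof.
suff H : (fun h : R => h^-1 *: (((h *: v + y).1 : R) - y.1)) @ 0^' --> v.1.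
  apply: DeriveDef; first by apply/cvg_ex; exists v.1.
  exact: (cvg_lim (@Rhausdorff R) H).
apply: cvg_near_cst; near=> h => /=.
have h0 : h != 0 by near: h; exact: nbhs_dnbhs_neq.
by rewrite addrK -[LHS]/(h^-1 * (h * v.1)) mulKf.
Unshelve. all: by end_near. Qed.

Lemma is_derive_proj2 (y v : R * R) : is_derive y v (@snd R R : R * R -> R) v.2.
Proof.
suff H : (fun h : R => h^-1 *: (((h *: v + y).2 : R) - y.2)) @ 0^' --> v.2.
  apply: DeriveDef; first by apply/cvg_ex; exists v.2.
  exact: (cvg_lim (@Rhausdorff R) H).
apply: cvg_near_cst; near=> h => /=.
have h0 : h != 0 by near: h; exact: nbhs_dnbhs_neq.
by rewrite addrK -[LHS]/(h^-1 * (h * v.2)) mulKf.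
Unshelve. all: by end_near. Qed.

(** This class is stable under partial derivatives, so one coinduction yields all closure properties
    of smooth functions at once. Smooth functions enter as generators, and an inverse asks for
    non-vanishing on [U] alone. *)
Inductive ratclass U : (R * R -> R) -> Prop :=
| rat_smooth f of smooth_on_open U f : ratclass U f
| rat_cst c : ratclass U (fun=> c)
| rat_fst : ratclass U (fun y => y.1)
| rat_snd : ratclass U (fun y => y.2)
| rat_add f g of ratclass U f & ratclass U g : ratclass U (fun y => f y + g y)
| rat_mul f g of ratclass U f & ratclass U g : ratclass U (fun y => f y * g y)
| rat_inv f of ratclass U f & (forall y, U y -> f y != 0) :
    ratclass U (fun y => (f y)^-1).

Lemma rat_is_smooth U f : open U -> ratclass U f -> smooth_on_open U f.
Proof.
move=> oU; apply: (smooth_coind oU) => {f} f.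
elim=> {f} [f sf|c|||f g Sf [cf df pf] Sg [cg dg pg]
  |f g Sf [cf df pf] Sg [cg dg pg]|f Sf [cf df pf] f0].
- split; [by move=> y Uy; exact: (smooth_continuous sf Uy)|
    by move=> a y Uy; exact: (smooth_derivable sf Uy)|].
  by move=> a; exists (pderiv a f) => //; exact/rat_smooth/smooth_pderiv.
- split; [by move=> y _; exact: cvg_cst|by move=> *; exact: derivable_cst|].
  by move=> a; exists (fun=> 0); [exact: rat_cst|move=> y _; exact: derive_cst].
- split; [by move=> y _; exact: cvg_fst|by move=> a y _; have [] := is_derive_proj1 y (basis_vec R a)|].
  move=> a; exists (fun=> (basis_vec R a).1); first exact: rat_cst.
  by move=> y _; have [_] := is_derive_proj1 y (basis_vec R a).
- split; [by move=> y _; exact: cvg_snd|by move=> a y _; have [] := is_derive_proj2 y (basis_vec R a)|].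
  move=> a; exists (fun=> (basis_vec R a).2); first exact: rat_cst.
  by move=> y _; have [_] := is_derive_proj2 y (basis_vec R a).
- split; [by move=> y Uy; apply: cvgD; [exact: cf|exact: cg]|
    by move=> a y Uy; apply: derivableD; [exact: df|exact: dg]|].
  move=> a; have [f' Sf' ff'] := pf a; have [g' Sg' gg'] := pg a.
  exists (fun y => f' y + g' y); first exact: rat_add.
  move=> y Uy; rewrite -ff'// -gg'//; apply: deriveD; [exact: df|exact: dg].
- split; [by move=> y Uy; apply: cvgM; [exact: cf|exact: cg]|
    by move=> a y Uy; apply: derivableM; [exact: df|exact: dg]|].
  move=> a; have [f' Sf' ff'] := pf a; have [g' Sg' gg'] := pg a.
  exists (fun y => f y * g' y + g y * f' y); first by apply: rat_add; exact: rat_mul.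
  move=> y Uy; rewrite -ff'// -gg'//; apply: deriveM; [exact: df|exact: dg].
- split; [by move=> y Uy; apply: cvgV; [exact: f0|exact: cf]|
    by move=> a y Uy; apply: derivableV; [exact: f0|exact: df]|].
  move=> a; have [f' Sf' ff'] := pf a.
  (* This is - f' / f^2, written with constructors of [ratclass] only. *)
  exists (fun y => (-1) * ((f y)^-1 * (f y)^-1 * f' y)).
    apply: rat_mul; first exact: rat_cst.
    by apply: rat_mul => //; apply: rat_mul; exact: rat_inv.
  move=> y Uy; rewrite -ff'// /pderiv deriveV; [|exact: f0|exact: df].
  by rewrite -[LHS]/(- f y ^- 2 * _) mulN1r mulNr expr2 invfM.
Qed.

Section closure.
Variables (U : set (R * R)) (oU : open U).

Lemma smooth_cst c : smooth_on_open U (fun=> c).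
Proof. exact/(rat_is_smooth oU)/rat_cst. Qed.

Lemma smoothD f g : smooth_on_open U f -> smooth_on_open U g ->
  smooth_on_open U (fun y => f y + g y).
Proof. by move=> sf sg; apply/(rat_is_smooth oU)/rat_add; exact: rat_smooth. Qed.

Lemma smoothM f g : smooth_on_open U f -> smooth_on_open U g ->
  smooth_on_open U (fun y => f y * g y).
Proof. by move=> sf sg; apply/(rat_is_smooth oU)/rat_mul; exact: rat_smooth. Qed.

Lemma smoothN f : smooth_on_open U f -> smooth_on_open U (fun y => - f y).
Proof.
move=> sf; apply: (@smooth_ext _ (fun y => (-1) * f y)) => //.
  by move=> y _; rewrite mulN1r.
by apply: smoothM => //; exact: smooth_cst.
Qed.

Lemma smoothB f g : smooth_on_open U f -> smooth_on_open U g ->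
  smooth_on_open U (fun y => f y - g y).
Proof. by move=> sf sg; apply: smoothD => //; exact: smoothN. Qed.

Lemma smoothV f : smooth_on_open U f -> (forall y, U y -> f y != 0) ->
  smooth_on_open U (fun y => (f y)^-1).
Proof. by move=> sf f0; apply/(rat_is_smooth oU)/rat_inv => //; exact: rat_smooth. Qed.

Lemma smooth_sum (I : Type) (s : seq I) (p : pred I) (F : I -> R * R -> R) :
  (forall i, p i -> smooth_on_open U (F i)) ->
  smooth_on_open U (fun y => \sum_(i <- s | p i) F i y).
Proof.
move=> sF; elim: s => [|i s IH].
  apply: (@smooth_ext _ (fun=> 0)) => //; last exact: smooth_cst.
  by move=> y _; rewrite big_nil.
case pi : (p i).
  apply: (@smooth_ext _ (fun y => F i y + \sum_(i <- s | p i) F i y)) => //.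
    by move=> y _; rewrite big_cons pi.
  by apply: smoothD => //; exact: sF.
by apply: smooth_ext IH => // y _; rewrite big_cons pi.
Qed.

Lemma smooth_prod (I : Type) (s : seq I) (p : pred I) (F : I -> R * R -> R) :
  (forall i, p i -> smooth_on_open U (F i)) ->
  smooth_on_open U (fun y => \prod_(i <- s | p i) F i y).
Proof.
move=> sF; elim: s => [|i s IH].
  apply: (@smooth_ext _ (fun=> 1)) => //; last exact: smooth_cst.
  by move=> y _; rewrite big_nil.
case pi : (p i).
  apply: (@smooth_ext _ (fun y => F i y * \prod_(i <- s | p i) F i y)) => //.
    by move=> y _; rewrite big_cons pi.
  by apply: smoothM => //; exact: sF.
by apply: smooth_ext IH => // y _; rewrite big_cons pi.
Qed.

Lemma smooth_affine (a b c : R) : smooth_on_open U (fun y => a * y.1 + b * y.2 + c).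
Proof.
apply/(rat_is_smooth oU)/rat_add; last exact: rat_cst.
by apply: rat_add; apply: rat_mul; do ?[exact: rat_cst|exact: rat_fst|exact: rat_snd].
Qed.

Variables (f g : R * R -> R) (y : R * R) (a : 'I_2).
Hypotheses (sf : smooth_on_open U f) (sg : smooth_on_open U g) (Uy : U y).

Lemma pderivD : pderiv a (fun y => f y + g y) y = pderiv a f y + pderiv a g y.
Proof. by apply: deriveD; [exact: (smooth_derivable sf Uy)|exact: (smooth_derivable sg Uy)]. Qed.

Lemma pderivB : pderiv a (fun y => f y - g y) y = pderiv a f y - pderiv a g y.
Proof. by apply: deriveB; [exact: (smooth_derivable sf Uy)|exact: (smooth_derivable sg Uy)]. Qed.

Lemma pderivM : pderiv a (fun y => f y * g y) y =
  f y * pderiv a g y + g y * pderiv a f y.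
Proof. by apply: deriveM; [exact: (smooth_derivable sf Uy)|exact: (smooth_derivable sg Uy)]. Qed.

Lemma pderivV : f y != 0 -> pderiv a (fun y => (f y)^-1) y =
  - (f y ^- 2 * pderiv a f y).
Proof.
by move=> f0; rewrite -mulNr; apply: deriveV => //; exact: (smooth_derivable sf Uy).
Qed.

End closure.

Lemma pderiv_cst (a : 'I_2) (c : R) y : pderiv a (fun=> c) y = 0.
Proof. exact: derive_cst. Qed.

Lemma pderiv_affine (a : 'I_2) (k l m : R) y :
  pderiv a (fun y => k * y.1 + l * y.2 + m) y =
  k * (basis_vec R a).1 + l * (basis_vec R a).2.
Proof.
have H1 := is_derive_proj1 y (basis_vec R a).
have H2 := is_derive_proj2 y (basis_vec R a).
rewrite /pderiv.
have -> : (fun y : R * R => k * y.1 + l * y.2 + m) =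
  (k *: (@fst R R) + l *: (@snd R R) + cst m) by apply/funext.
rewrite deriveD ?deriveD ?deriveZ ?derive_cst ?addr0; last first.
- exact: derivable_cst.
- by apply: derivableD; apply: derivableZ; [case: H1|case: H2].
- by apply: derivableZ; case: H2.
- by apply: derivableZ; case: H1.
- by case: H2.
- by case: H1.
by have [_ ->] := H1; have [_ ->] := H2.
Qed.

(** Freezing the other coordinate turns a partial derivative into a one-variable derivative, to
    which the mean value theorem and the chain rule apply. *)
Definition slice (a : 'I_2) (f : R * R -> R) (y : R * R) (t : R) : R :=
  f (if a == 0 then (t, y.2) else (y.1, t)).

Definition axis_coord (a : 'I_2) (y : R * R) : R := if a == 0 then y.1 else y.2.

Lemma slice_growth a f y (h : R) :
  slice a f y (h *: 1 + axis_coord a y) = f (h *: basis_vec R a + y).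
Proof.
rewrite /slice /axis_coord /basis_vec; case: y => y1 y2; case: (a == 0) => /=;
 by congr f; congr pair; rewrite // -[RHS]/(h * 0 + _) mulr0 add0r.
Qed.

Lemma slice_coord a f y : slice a f y (axis_coord a y) = f y.
Proof. by rewrite /slice /axis_coord; case: y => y1 y2; case: (a == 0). Qed.

Lemma slice_derivable a f y :
  derivable f y (basis_vec R a) -> derivable (slice a f y) (axis_coord a y) 1.
Proof.
rewrite /derivable; set F := (X in X @ 0^' ) ; set G := (X in _ -> cvg (X @ 0^')).
by suff -> : G = F by []; apply/funext => h; congr (_ *: (_ - _));
 [exact: slice_growth|exact: slice_coord].
Qed.

Lemma slice_derive a f y : 'D_1 (slice a f y) (axis_coord a y) = pderiv a f y.
Proof.
rewrite /pderiv /derive; congr (lim (_ @ 0^')).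
by apply/funext => h; congr (_ *: (_ - _));
 [exact: slice_growth|exact: slice_coord].
Qed.

End Smooth.

(** * Symmetry of second partial derivatives *)

Section Schwarz.
Variable R : realType.
Implicit Types (U : set (R * R)) (f g : R * R -> R).

Lemma is_derive_slice U f a y : smooth_on_open U f -> U y ->
  is_derive (axis_coord a y) 1 (slice a f y) (pderiv a f y).
Proof.
move=> sf Uy; apply: DeriveDef; last exact: slice_derive.
exact: (slice_derivable (smooth_derivable sf Uy)).
Qed.

Lemma is_derive_fst U f (s t : R) : smooth_on_open U f -> U (s, t) ->
  is_derive s 1 (fun x => f (x, t)) (pderiv 0 f (s, t)).
Proof. by move=> sf Uy; exact: (is_derive_slice 0 sf Uy). Qed.

Lemma is_derive_snd U f (s t : R) : smooth_on_open U f -> U (s, t) ->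
  is_derive t 1 (fun x => f (s, x)) (pderiv 1 f (s, t)).
Proof. by move=> sf Uy; exact: (is_derive_slice 1 sf Uy). Qed.

Lemma MVT_is_derive (f df : R -> R) (x h : R) : 0 < h ->
  (forall t, x <= t <= x + h -> is_derive t 1 f (df t)) ->
  exists2 t, x <= t <= x + h & f (x + h) - f x = h * df t.
Proof.
move=> h0 dfE; have xh : x < x + h by rewrite ltrDl.
have [||t + ->] := MVT xh (f := f) (df := df).
- by move=> t; rewrite in_itv/= => /andP[/ltW ? /ltW ?]; apply: dfE; apply/andP.
- apply: derivable_within_continuous => t; rewrite in_itv/= => /dfE dt.
  exact: ex_derive.
- by rewrite in_itv/= => /andP[/ltW xt /ltW tx]; exists t; [apply/andP|ring].
Qed.

(** The mean value theorem is applied first to s |-> f (s, y + h) - f (s, y), then to the first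
    partial derivative in the other variable. The next lemma takes the variables in the opposite
    order, with the same left-hand side. *)
Lemma second_difference U f (x y h : R) : 0 < h -> smooth_on_open U f ->
  (forall s t, x <= s <= x + h -> y <= t <= y + h -> U (s, t)) ->
  exists s t, [/\ x <= s <= x + h, y <= t <= y + h &
    (f (x + h, y + h) - f (x + h, y)) - (f (x, y + h) - f (x, y))
      = h * h * pderiv 1 (pderiv 0 f) (s, t)].
Proof.
move=> h0 sf HU.
have xx : x <= x <= x + h by lra.
have yy : y <= y <= y + h by lra.
have yh : y <= y + h <= y + h by lra.
have [s xs E1] := @MVT_is_derive (fun s => f (s, y + h) - f (s, y))
  (fun s => pderiv 0 f (s, y + h) - pderiv 0 f (s, y)) x h h0
  (fun s xs => is_deriveB (is_derive_fst sf (HU _ _ xs yh)) (is_derive_fst sf (HU _ _ xs yy))).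
have [t yt E2] := @MVT_is_derive (fun t => pderiv 0 f (s, t))
  (fun t => pderiv 1 (pderiv 0 f) (s, t)) y h h0
  (fun t yt => is_derive_snd (smooth_pderiv 0 sf) (HU _ _ xs yt)).
by exists s, t; split => //; rewrite E1 E2 mulrA.
Qed.

Lemma second_difference_swap U f (x y h : R) : 0 < h -> smooth_on_open U f ->
  (forall s t, x <= s <= x + h -> y <= t <= y + h -> U (s, t)) ->
  exists s t, [/\ x <= s <= x + h, y <= t <= y + h &
    (f (x + h, y + h) - f (x + h, y)) - (f (x, y + h) - f (x, y))
      = h * h * pderiv 0 (pderiv 1 f) (s, t)].
Proof.
move=> h0 sf HU.
have xx : x <= x <= x + h by lra.
have yy : y <= y <= y + h by lra.
have xh : x <= x + h <= x + h by lra.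
have [t yt E1] := @MVT_is_derive (fun t => f (x + h, t) - f (x, t))
  (fun t => pderiv 1 f (x + h, t) - pderiv 1 f (x, t)) y h h0
  (fun t yt => is_deriveB (is_derive_snd sf (HU _ _ xh yt)) (is_derive_snd sf (HU _ _ xx yt))).
have [s xs E2] := @MVT_is_derive (fun s => pderiv 1 f (s, t))
  (fun s => pderiv 0 (pderiv 1 f) (s, t)) x h h0
  (fun s xs => is_derive_fst (smooth_pderiv 1 sf) (HU _ _ xs yt)).
exists s, t; split => //; rewrite -mulrA -E2 -E1; ring.
Qed.

Lemma continuous_dist (f : R * R -> R) y e : {for y, continuous f} -> 0 < e ->
  \forall z \near y, `|f y - f z| < e.
Proof. by move=> /cvgr_dist_lt cf e0; exact: cf. Qed.

Lemma ler_dist_close (a a' b b' e : R) : `|a - a'| < e / 2 -> `|b - b'| < e / 2 ->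
  a' = b' -> `|a - b| <= e.
Proof. by move=> + + ab; rewrite -{}ab !ltr_norml ler_norml; lra. Qed.

(** Both mixed derivatives take a common value, the second difference divided by the area, at points
    of one small square. By continuity each is within e / 2 there of its value at [y]. *)
Lemma schwarz01 U f y : open U -> smooth_on_open U f -> U y ->
  pderiv 1 (pderiv 0 f) y = pderiv 0 (pderiv 1 f) y.
Proof.
move=> oU sf Uy.
set A := pderiv 1 (pderiv 0 f); set B := pderiv 0 (pderiv 1 f).
apply/eqP; rewrite -subr_eq0 -normr_le0; apply/ler_addgt0Pr => e e0; rewrite add0r.
have e20 : 0 < e / 2 by lra.
have cA : {for y, continuous A} by apply: smooth_continuous Uy; do 2!apply: smooth_pderiv.
have cB : {for y, continuous B} by apply: smooth_continuous Uy; do 2!apply: smooth_pderiv.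
have nU : \forall z \near y, U z by exact: open_nbhs_nbhs.
have nA : \forall z \near y, `|A y - A z| < e / 2 by exact: continuous_dist cA e20.
have nB : \forall z \near y, `|B y - B z| < e / 2 by exact: continuous_dist cB e20.
have : \forall z \near y, [/\ U z, `|A y - A z| < e / 2 & `|B y - B z| < e / 2].
  by apply: filterS3 nU nA nB => z *; split.
move=> /nbhs_ballP[r /= r0 Hr].
case: y Uy cA cB nU nA nB Hr => x y Uy cA cB _ _ _ Hr.
(* A closed square with its lower left corner at the base point and side r / 2 stays inside the open
   ball of radius r. *)
have Hb s t : x <= s <= x + r / 2 -> y <= t <= y + r / 2 ->
    ball (x, y) r (s, t).
  by move=> xs yt; split; rewrite /ball /= ltr_norml; apply/andP; split; lra.
have r20 : 0 < r / 2 by lra.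
have HU s t : x <= s <= x + r / 2 -> y <= t <= y + r / 2 -> U (s, t).
  by move=> xs yt; have [] := Hr _ (Hb _ _ xs yt).
have [s [t [xs yt E1]]] := second_difference r20 sf HU.
have [s' [t' [xs' yt' E2]]] := second_difference_swap r20 sf HU.
have [_ A1 _] := Hr _ (Hb s t xs yt).
have [_ _ B1] := Hr _ (Hb s' t' xs' yt').
apply: (ler_dist_close A1 B1); apply: (@mulfI _ (r / 2 * (r / 2))).
  by rewrite mulf_neq0 ?gt_eqF.
exact: etrans (esym E1) E2.
Qed.

Lemma ord2P (P : 'I_2 -> Prop) : P 0 -> P 1 -> forall a, P a.
Proof.
move=> P0 P1 a; case: a => -[|[|//]] Ha; [move: P0|move: P1];
 by congr P; apply: val_inj.
Qed.

Lemma schwarz U f y a b : open U -> smooth_on_open U f -> U y ->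
  pderiv a (pderiv b f) y = pderiv b (pderiv a f) y.
Proof.
move=> oU sf Uy; move: a b; apply: ord2P; apply: ord2P.
- exact: erefl.
- exact: esym (schwarz01 oU sf Uy).
- exact: schwarz01 oU sf Uy.
- exact: erefl.
Qed.

End Schwarz.

(** * Lebesgue measure on the plane *)

Section Measure.
Variable R : realType.
Implicit Types (f g : R * R -> R).

Notation RR := (measurableTypeR R * measurableTypeR R)%type.
Notation mu := (@leb2 R).

Definition rat_box (q : (rat * rat) * (rat * rat)) : set (R * R) :=
  `]ratr q.1.1, ratr q.1.2[ `*` `]ratr q.2.1, ratr q.2.2[.

Lemma rat_itv_ball (x e : R) : 0 < e ->
  exists p q : rat, (ratr p < x < ratr q) /\ (x - e < ratr p) /\ (ratr q < x + e).
Proof.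
move=> e0; have [|p + ] := @rat_in_itvoo R (x - e) x; first by lra.
have [|q + ] := @rat_in_itvoo R x (x + e); first by lra.
rewrite !in_itv/= => /andP[xq qx] /andP[xp px].
by exists p, q; rewrite px xq.
Qed.

(** This links the product topology to the product sigma-algebra: an open set is the countable union
    of the rational boxes that it contains. *)
Lemma open_measurable2 (O : set (R * R)) : open O -> measurable (O : set RR).
Proof.
move=> oO.
(* A box that is not contained in [O] is replaced by the empty set, so that the index type stays
   countable as it is. *)
have -> : O = \bigcup_(q : (rat * rat) * (rat * rat))
    (if `[< rat_box q `<=` O >] then rat_box q else set0).
  apply/seteqP; split=> [y Oy|y [q _]]; last by case: asboolP => // qO /qO.
  have /nbhs_ballP[e /= e0 eO] : nbhs y O by exact: open_nbhs_nbhs.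
  have [p1 [q1 [/andP[a1 b1] [c1 d1]]]] := rat_itv_ball y.1 e0.
  have [p2 [q2 [/andP[a2 b2] [c2 d2]]]] := rat_itv_ball y.2 e0.
  exists ((p1, q1), (p2, q2)) => //=; case: asboolP => [_|[]].
    by split; rewrite /= in_itv/=; apply/andP.
  move=> z [/=]; rewrite !in_itv/= => /andP[z1 z1'] /andP[z2 z2'].
  apply: eO; split; rewrite /ball /= ltr_norml; apply/andP; split; lra.
apply: countable_bigcupT_measurable; first exact: countableP.
move=> q; case: ifP => _; last exact: measurable0.
by apply: measurableX; exact: measurable_itv.
Qed.

Lemma continuous_measurable2 (O : set (R * R)) f : open O ->
  (forall y, O y -> {for y, continuous f}) ->
  measurable_fun (O : set RR) (f : RR -> R).
Proof.
move=> oO cf; apply: (measurability _ (RGenOpens.measurableE R)).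
move=> _ [_ [a [b ->] <-]]; apply: open_measurable2.
rewrite openE => y [Oy fy]; apply: filterI; first exact: open_nbhs_nbhs.
by apply: (cf y Oy); apply: open_nbhs_nbhs; split => //; exact: interval_open.
Qed.

Lemma bounded_setP (V : normedModType R) (A : set V) : bounded_set A ->
  exists M, forall y, A y -> `|y| <= M.
Proof. by move=> [M [_ HM]]; exists (M + 1) => y; apply: HM; rewrite ltrDl. Qed.

Lemma leb2_bounded_fin (O : set (R * R)) : open O -> bounded_set O ->
  (mu O < +oo)%E.
Proof.
move=> oO /bounded_setP[M HM].
have sub : O `<=` `[- M, M] `*` `[- M, M].
  move=> y /HM; rewrite /Num.norm/= ge_max => /andP[y1 y2].
  by split; rewrite /= in_itv/= -ler_norml.
have mI : measurable (`[- M, M] `*` `[- M, M] : set RR).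
  by apply: measurableX; exact: measurable_itv.
apply: (@le_lt_trans _ _ (mu (`[- M, M] `*` `[- M, M] : set RR))).
  by apply: le_measure => //; rewrite inE //; exact: open_measurable2.
rewrite /leb2 product_measure1E; [|exact: measurable_itv|exact: measurable_itv].
rewrite -[X in (X * _)%E]fineK; last first.
  by rewrite ge0_fin_numE// compact_finite_measure//; exact: segment_compact.
rewrite -[X in (_ * X)%E]fineK -?EFinM ?ltry//.
by rewrite ge0_fin_numE// compact_finite_measure//; exact: segment_compact.
Qed.

Lemma bounded_on_compact (P : set (R * R)) f : compact P ->
  (forall y, P y -> {for y, continuous f}) ->
  exists M, forall y, P y -> `|f y| <= M.
Proof.
move=> cP cf.
have /compact_bounded/bounded_setP[M HM] : compact (f @` P).
  apply: continuous_compact => //; apply: continuous_in_subspaceT.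
  by move=> y; rewrite inE; exact: cf.
by exists M => y Py; apply: HM; exists y.
Qed.

Lemma integrable2 (O : set (R * R)) f (M : R) : open O -> bounded_set O ->
  (forall y, O y -> {for y, continuous f}) -> (forall y, O y -> `|f y| <= M) ->
  mu.-integrable (O : set RR) (EFin \o f).
Proof.
move=> oO bO cf fM; apply: measurable_bounded_integrable.
- exact: open_measurable2.
- exact: leb2_bounded_fin.
- exact: continuous_measurable2.
- exists M; split; first exact: num_real.
  by move=> x /ltW Mx y /fM fy; exact: le_trans Mx.
Qed.

(** Openness keeps [S] from attaining its bounds; convexity fills in everything between them. *)
Lemma open_interval_itv (S : set R) : open S -> is_interval S -> S !=set0 ->
  has_lbound S -> has_ubound S -> S = `]inf S, sup S[%classic.
Proof.
move=> oS iS S0 lS uS; apply/seteqP; split=> t; rewrite /= in_itv/=.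
  move=> St; have /nbhs_ballP[e /= e0 eS] : nbhs t S by exact: open_nbhs_nbhs.
  have /(ge_inf lS) Sl : S (t - e / 2).
    by apply: eS; rewrite /ball/= ltr_norml; apply/andP; split; lra.
  have /(ub_le_sup uS) Su : S (t + e / 2).
    by apply: eS; rewrite /ball/= ltr_norml; apply/andP; split; lra.
  by apply/andP; split; lra.
move=> /andP[/(inf_lt S0)[x Sx xt] /(sup_gt S0)[z Sz tz]].
by apply: (iS x z) => //; rewrite (ltW xt) (ltW tz).
Qed.

Lemma closure_inf (S : set R) : S !=set0 -> has_lbound S -> closure S (inf S).
Proof.
move=> S0 lS B /nbhs_ballP[e /= e0 eB].
have [y Sy yl] := inf_adherent e0 (conj S0 lS).
have := ge_inf lS Sy => ly.
by exists y; split => //; apply: eB; rewrite /ball/= ltr_norml; apply/andP; split; lra.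
Qed.

(** [S] is an open interval whose endpoints lie in the closed set [K] but not in [S]. Hence [F]
    vanishes at both, and the fundamental theorem of calculus gives 0. In the application [S] and
    [K] are the slices of the open and of the closed polytope. *)
Lemma integral_derivative_vanish (S K : set R) (F F' : R -> R) :
  open S -> is_interval S -> has_lbound S -> has_ubound S ->
  closed K -> S `<=` K ->
  (forall t, K t -> is_derive t 1 F (F' t)) ->
  (forall t, K t -> {for t, continuous F'}) ->
  (forall t, K t -> ~ S t -> F t = 0) ->
  (\int[lebesgue_measure]_(t in S) (F' t)%:E)%E = 0%E.
Proof.
move=> oS iS lS uS cK SK dF cF F0.
have [->|/set0P S0] := eqVneq S set0; first by rewrite integral_set0.
have SE := open_interval_itv oS iS S0 lS uS.
set a := inf S in SE; set b := sup S in SE.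
have Ka : K a by apply: cK; apply: (closure_subset SK); exact: closure_inf.
have Kb : K b by apply: cK; apply: (closure_subset SK); exact: closure_sup.
have Sa : ~ S a by rewrite SE /= in_itv/= ltxx.
have Sb : ~ S b by rewrite SE /= in_itv/= ltxx andbF.
have ab : a < b.
  by case: S0 => t; rewrite SE /= in_itv/= => /andP[]; exact: lt_trans.
have Kab t : a <= t <= b -> K t.
  rewrite !le_eqVlt => /andP[/orP[/eqP<-//|at_] /orP[/eqP->//|tb]].
  by apply: SK; rewrite SE /= in_itv/= at_.
have cFab : {within `[a, b], continuous F'}.
  by apply: continuous_in_subspaceT => t; rewrite inE/= in_itv/= => /Kab; exact: cF.
have cF1 t : K t -> {for t, continuous F}.
  move=> /dF dt; apply: differentiable_continuous; apply/derivable1_diffP.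
  exact: ex_derive.
rewrite SE -(@integral_itv_bndoo _ a b _ true false); last first.
  apply/measurable_EFinP; apply: open_continuous_measurable_fun.
    exact: interval_open.
  move=> t; rewrite inE/= in_itv/= => /andP[/ltW at_ /ltW tb]; apply/cF/Kab.
  by rewrite at_.
rewrite (@continuous_FTC2 _ F' F)//.
- by rewrite (F0 _ Ka Sa) (F0 _ Kb Sb) subee.
- split.
  + move=> t; rewrite in_itv/= => /andP[/ltW at_ /ltW tb].
    have Kt : K t by apply: Kab; rewrite at_.
    by have := dF _ Kt => dt; exact: ex_derive.
  + by apply: cvg_at_right_filter; exact: cF1.
  + by apply: cvg_at_left_filter; exact: cF1.
- move=> t; rewrite in_itv/= => /andP[/ltW at_ /ltW tb].
  have Kt : K t by apply: Kab; rewrite at_.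
  by rewrite derive1E; have := dF _ Kt => dt; exact: derive_val.
Qed.

End Measure.

(** * The divergence theorem on a polytope *)

Section Fubini.
Variable R : realType.
Implicit Types (f g : R * R -> R).

Notation RR := (measurableTypeR R * measurableTypeR R)%type.
Notation mu := (@leb2 R).

Variables (P Q U : set (R * R)).
Hypotheses (cP : compact P) (oQ : open Q) (QP : Q `<=` P).
Hypotheses (oU : open U) (PU : P `<=` U).
Hypothesis iQ1 : forall t, is_interval [set s | Q (s, t)].
Hypothesis iQ2 : forall s, is_interval [set t | Q (s, t)].

Lemma bounded_sub_compact : bounded_set Q.
Proof.
have [M HM] := bounded_setP (compact_bounded cP).
by exists M; split; [exact: num_real|move=> x /ltW Mx y /QP /HM/le_trans]; apply.
Qed.

Lemma smooth_bounded f : smooth_on_open U f ->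
  exists M, forall y, P y -> `|f y| <= M.
Proof.
by move=> sf; apply: bounded_on_compact => // y /PU Uy; exact: (smooth_continuous sf Uy).
Qed.

Lemma smooth_integrable f : smooth_on_open U f ->
  mu.-integrable (Q : set RR) (EFin \o f).
Proof.
move=> sf; have [M HM] := smooth_bounded sf.
apply: (@integrable2 _ _ _ M) => //; first exact: bounded_sub_compact.
- by move=> y /QP/PU Uy; exact: (smooth_continuous sf Uy).
- by move=> y /QP; exact: HM.
Qed.

Lemma continuous_pairl (t : R) : continuous (fun s : R => (s, t)).
Proof. by move=> s; apply: (@cvg_pair _ _ _ _ (nbhs s) (nbhs t)); [exact: cvg_id|exact: cvg_cst]. Qed.

Lemma continuous_pairr (s : R) : continuous (fun t : R => (s, t)).
Proof. by move=> t; apply: (@cvg_pair _ _ _ _ (nbhs s) (nbhs t)); [exact: cvg_cst|exact: cvg_id]. Qed.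

Lemma compact_set_closed : closed P.
Proof. by apply: compact_closed => //; exact: norm_hausdorff. Qed.

Lemma slice_fst_vanish f t : smooth_on_open U f ->
  (forall y, P y -> ~ Q y -> f y = 0) ->
  (\int[lebesgue_measure]_(s in [set s | Q (s, t)]) (pderiv 0 f (s, t))%:E)%E = 0%E.
Proof.
move=> sf f0; have [M HM] := bounded_setP bounded_sub_compact.
have HM' s : Q (s, t) -> - M <= s <= M.
  by move=> /HM; rewrite /Num.norm/= ge_max => /andP[+ _]; rewrite ler_norml.
apply: (@integral_derivative_vanish _ _ [set s | P (s, t)] (fun s => f (s, t))).
- by apply: (open_comp _ oQ) => s _; exact: continuous_pairl.
- exact: iQ1.
- by exists (- M) => s /HM'/andP[].
- by exists M => s /HM'/andP[].
- by apply: (closed_comp _ compact_set_closed) => s _; exact: continuous_pairl.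
- by move=> s /QP.
- by move=> s /PU Us; exact: (is_derive_fst sf Us).
- move=> s /PU Us; apply: continuous_comp; first exact: continuous_pairl.
  exact: (smooth_continuous (smooth_pderiv 0 sf) Us).
- by move=> s; exact: f0.
Qed.

Lemma slice_snd_vanish f s : smooth_on_open U f ->
  (forall y, P y -> ~ Q y -> f y = 0) ->
  (\int[lebesgue_measure]_(t in [set t | Q (s, t)]) (pderiv 1 f (s, t))%:E)%E = 0%E.
Proof.
move=> sf f0; have [M HM] := bounded_setP bounded_sub_compact.
have HM' t : Q (s, t) -> - M <= t <= M.
  by move=> /HM; rewrite /Num.norm/= ge_max => /andP[_]; rewrite ler_norml.
apply: (@integral_derivative_vanish _ _ [set t | P (s, t)] (fun t => f (s, t))).
- by apply: (open_comp _ oQ) => t _; exact: continuous_pairr.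
- exact: iQ2.
- by exists (- M) => t /HM'/andP[].
- by exists M => t /HM'/andP[].
- by apply: (closed_comp _ compact_set_closed) => t _; exact: continuous_pairr.
- by move=> t /QP.
- by move=> t /PU Us; exact: (is_derive_snd sf Us).
- move=> t /PU Us; apply: continuous_comp; first exact: continuous_pairr.
  exact: (smooth_continuous (smooth_pderiv 1 sf) Us).
- by move=> t; exact: f0.
Qed.

(** Fubini, with the order chosen so that the inner integral runs along axis [a]; each inner
    integral vanishes because [f] is 0 at the ends of the slice. *)
Lemma integral_pderiv_vanish a f : smooth_on_open U f ->
  (forall y, P y -> ~ Q y -> f y = 0) ->
  \int[mu]_(y in Q) pderiv a f y = 0.
Proof.
move=> sf f0; suff : (\int[mu]_(y in Q) (pderiv a f y)%:E)%E = 0%E.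
  by move=> H; rewrite /Rintegral H.
have := smooth_integrable (smooth_pderiv a sf).
(* Fubini is applied on the whole plane, to the integrand extended by 0 off [Q]; the extension
   restricts slicewise to the extension of the slice. *)
move=> /(integrable_mkcond _ (open_measurable2 oQ)) ig.
rewrite integral_mkcond.
move: a ig; apply: ord2P => ig.
- have := integral21_prod_meas1 ig; rewrite /comp => <-.
  rewrite integral0_eq// => t _; rewrite /fubini_G.
  rewrite -[RHS](slice_fst_vanish t sf f0) [RHS]integral_mkcond.
  apply: eq_integral => s _; rewrite !patchE.
  by congr (if _ then _ else _); apply/idP/idP; rewrite !inE.
- have := integral12_prod_meas1 ig; rewrite /comp => <-.
  rewrite integral0_eq// => s _; rewrite /fubini_F.
  rewrite -[RHS](slice_snd_vanish s sf f0) [RHS]integral_mkcond.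
  apply: eq_integral => t _; rewrite !patchE.
  by congr (if _ then _ else _); apply/idP/idP; rewrite !inE.
Qed.

End Fubini.

(** * The interior of a polytope and vector fields tangent to its boundary *)

Section PolytopeGeometry.
Variables (R : realType) (N : nat) (nu : 'I_N -> int * int) (c : 'I_N -> R).

Notation P := (polytope nu c).
Notation RR := (measurableTypeR R * measurableTypeR R)%type.
Notation mu := (@leb2 R).

Definition open_polytope : set (R * R) := [set y | forall r, 0 < ell nu c r y].
Notation Q := open_polytope.

(** A defining function of the boundary: positive on the open polytope, zero on the rest of [P]. *)
Definition facet_prod (y : R * R) : R := \prod_r ell nu c r y.

Lemma smooth_ell U r : open U -> smooth_on_open U (ell nu c r).
Proof. by move=> oU; exact: smooth_affine. Qed.

Lemma continuous_ell r : continuous (ell nu c r).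
Proof. by move=> y; apply: (smooth_continuous (smooth_ell r openT)). Qed.

Lemma open_open_polytope : open Q.
Proof.
rewrite openE => y Qy; rewrite /interior /=.
apply: (@filter_forall _ _ _ (nbhs y)) => r.
by have /cvgr_gt := @continuous_ell r y; apply; exact: Qy.
Qed.

Lemma open_polytope_sub : Q `<=` P.
Proof. by move=> y Qy r; exact: ltW. Qed.

(** Primitive conormals are nonzero. If some l^r vanished at an interior point, a step of e / 2
    along a coordinate axis on which nu_r is nonzero, against its sign, would stay in [P] and make
    l^r negative. *)
Lemma interior_polytope : (forall r, coprimez (nu r).1 (nu r).2) -> P° = Q.
Proof.
move=> co; apply/seteqP; split; last first.
  by rewrite -open_subsetE; [exact: open_polytope_sub|exact: open_open_polytope].
move=> y /nbhs_ballP[e /= e0 eP] r.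
rewrite lt_neqAle (eP y (ballxx _ e0) r) andbT eq_sym; apply/negP => /eqP ly0.
have Hb (s t : R) : `|s| <= 1 -> `|t| <= 1 ->
    0 <= ell nu c r (y.1 - s * (e / 2), y.2 - t * (e / 2)).
  move=> s1 t1; apply: eP; split; rewrite /ball /= opprB addrC subrK normrM.
    by rewrite (gtr0_norm (_ : 0 < e / 2)); [nra|lra].
  by rewrite (gtr0_norm (_ : 0 < e / 2)); [nra|lra].
have [n1|n1] := eqVneq (nu r).1 0.
  have n2 : (nu r).2 != 0.
    (* The gcd of 0 and 0 is 0, so the zero vector is not primitive. *)
    by apply/eqP => n2; have := co r; rewrite n1 n2.
  have := Hb 0 (Num.sg (nu r).2%:~R); rewrite normr0 normr_sg intr_eq0 n2.
  move=> /(_ ler01 (lexx _)).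
  have : ell nu c r (y.1 - 0 * (e / 2), y.2 - Num.sg (nu r).2%:~R * (e / 2))
     = ell nu c r y - `|(nu r).2%:~R| * (e / 2) :> R.
    by rewrite normrEsg /ell /=; ring.
  move=> ->; rewrite ly0 sub0r oppr_ge0 leNgt => /negP; apply.
  by rewrite mulr_gt0 ?normr_gt0 ?intr_eq0//; lra.
have := Hb (Num.sg (nu r).1%:~R) 0; rewrite normr0 normr_sg intr_eq0 n1.
move=> /(_ (lexx _) ler01).
have : ell nu c r (y.1 - Num.sg (nu r).1%:~R * (e / 2), y.2 - 0 * (e / 2))
   = ell nu c r y - `|(nu r).1%:~R| * (e / 2) :> R.
  by rewrite normrEsg /ell /=; ring.
move=> ->; rewrite ly0 sub0r oppr_ge0 leNgt => /negP; apply.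
by rewrite mulr_gt0 ?normr_gt0 ?intr_eq0//; lra.
Qed.

Lemma affine_interval_pos (a b x y z : R) : 0 < a * x + b -> 0 < a * y + b ->
  x <= z <= y -> 0 < a * z + b.
Proof.
move=> ax ay /andP[xz zy]; have [a0|a0] := leP 0 a.
  by rewrite (lt_le_trans ax)// lerD2r ler_wpM2l.
by rewrite (lt_le_trans ay)// lerD2r ler_wnM2l// ltW.
Qed.

Lemma open_polytope_slice_fst t : is_interval [set s | Q (s, t)].
Proof.
move=> x y Qx Qy z xzy r; have := Qx r; have := Qy r; rewrite /ell /= -!addrA.
by move=> Hy Hx; exact: (affine_interval_pos Hx Hy xzy).
Qed.

Lemma open_polytope_slice_snd s : is_interval [set t | Q (s, t)].
Proof.
move=> x y Qx Qy z xzy r; have := Qx r; have := Qy r; rewrite /ell /=.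
rewrite -!addrA ![_%:~R * s + _]addrC -!addrA => Hy Hx.
exact: (affine_interval_pos Hx Hy xzy).
Qed.

Lemma facet_prod_gt0 y : Q y -> 0 < facet_prod y.
Proof. by move=> Qy; apply: prodr_gt0 => r _. Qed.

Lemma facet_prod_ge0 y : P y -> 0 <= facet_prod y.
Proof. by move=> Py; apply: prodr_ge0 => r _. Qed.

Lemma facet_prod_eq0 y : P y -> ~ Q y -> facet_prod y = 0.
Proof.
move=> Py nQ; apply/eqP/prodf_eq0.
have [r /negP] : exists r, ~ 0 < ell nu c r y by apply/existsNP.
by rewrite -leNgt => lr; exists r => //; rewrite eq_le lr Py.
Qed.

Lemma smooth_facet_prod U : open U -> smooth_on_open U facet_prod.
Proof. by move=> oU; apply: smooth_prod => // r _; exact: smooth_ell. Qed.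

Hypothesis cP : compact P.
Variables (U : set (R * R)) (oU : open U) (PU : P `<=` U).

Lemma polytope_smooth_integrable f : smooth_on_open U f ->
  mu.-integrable (Q : set RR) (EFin \o f).
Proof.
exact: (smooth_integrable cP open_open_polytope open_polytope_sub PU).
Qed.

Variables (X : 'I_2 -> R * R -> R) (g : 'I_N -> R * R -> R).
Hypothesis sX : forall a, smooth_on_open U (X a).
Hypothesis sg : forall r, smooth_on_open U (g r).
Hypothesis Xg : forall r y, Q y ->
  (nu r).1%:~R * X 0 y + (nu r).2%:~R * X 1 y = ell nu c r y * g r y.

Lemma pderiv_ell a r y : pderiv a (ell nu c r) y =
  (nu r).1%:~R * (basis_vec R a).1 + (nu r).2%:~R * (basis_vec R a).2.
Proof. exact: pderiv_affine. Qed.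

(** By the Leibniz rule each factor contributes X . grad l^r = nu_r . X = l^r g_r, which restores
    the full product times g_r. An arbitrary list of facets makes the induction go through. *)
Lemma tangent_deriv_prod (s : seq 'I_N) y : Q y ->
  X 0 y * pderiv 0 (fun z => \prod_(r <- s) ell nu c r z) y +
  X 1 y * pderiv 1 (fun z => \prod_(r <- s) ell nu c r z) y =
  (\prod_(r <- s) ell nu c r y) * \sum_(r <- s) g r y.
Proof.
move=> Qy; elim: s => [|r s IH].
  have E : (fun z => \prod_(r <- [::]) ell nu c r z) = fun=> 1.
    by apply/funext => z; rewrite big_nil.
  by rewrite E !pderiv_cst !big_nil !mulr0 addr0.
have E : (fun z => \prod_(r <- r :: s) ell nu c r z) =
    fun z => ell nu c r z * \prod_(r <- s) ell nu c r z.
  by apply/funext => z; rewrite big_cons.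
have sp : smooth_on_open [set: R * R] (fun z => \prod_(r <- s) ell nu c r z).
  by apply: smooth_prod => [|i _]; [exact: openT|apply: smooth_ell; exact: openT].
have sl : smooth_on_open [set: R * R] (ell nu c r) by apply: smooth_ell; exact: openT.
rewrite E !(pderivM _ sl sp)// !pderiv_ell !big_cons /=.
set p := \prod_(_ <- s) _ in IH *; set G := \sum_(_ <- s) _ in IH *.
set d0 := pderiv 0 _ y in IH *; set d1 := pderiv 1 _ y in IH *.
have -> : X 0 y * (ell nu c r y * d0 + p * ((nu r).1%:~R * 1 + (nu r).2%:~R * 0)) +
  X 1 y * (ell nu c r y * d1 + p * ((nu r).1%:~R * 0 + (nu r).2%:~R * 1))
  = ell nu c r y * (X 0 y * d0 + X 1 y * d1) +
    p * ((nu r).1%:~R * X 0 y + (nu r).2%:~R * X 1 y) by ring.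
by rewrite IH Xg//; ring.
Qed.

Let cutoff (e : R) (y : R * R) := facet_prod y * (facet_prod y + e)^-1.
(** The product of the l^r can be negative off [P], so the cutoff is smooth only where its
    denominator is positive. For e > 0 this is still a neighbourhood of [P]. *)
Let V (e : R) := U `&` [set y | 0 < facet_prod y + e].

Let openV e : open (V e).
Proof.
apply: openI => //; rewrite openE => y /= Vy.
have : {for y, continuous (fun y => facet_prod y + e)}.
  apply: (@smooth_continuous _ setT) => //; apply: smoothD; first exact: openT.
    exact: (smooth_facet_prod openT).
  by apply: smooth_cst; exact: openT.
by move=> /cvgr_gt; exact.
Qed.

Let PV e : 0 < e -> P `<=` V e.
Proof.
move=> e0 y Py; split; first exact: PU.
by rewrite /= ltr_wpDl//; exact: facet_prod_ge0.
Qed.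

Let VU e : V e `<=` U. Proof. by move=> y []. Qed.

Let smooth_den e : smooth_on_open (V e) (fun y => facet_prod y + e).
Proof.
by apply: (smoothD (@openV e)); [exact: smooth_facet_prod|exact: smooth_cst].
Qed.

Let den0 e y : V e y -> facet_prod y + e != 0.
Proof. by move=> [_ Vy]; rewrite gt_eqF. Qed.

Let smooth_cutoff e : smooth_on_open (V e) (cutoff e).
Proof.
apply: smoothM => //; first exact: smooth_facet_prod.
by apply: smoothV => // y; exact: den0.
Qed.

Let smooth_cutX e a : smooth_on_open (V e) (fun y => cutoff e y * X a y).
Proof.
by apply: smoothM => //; apply: smooth_subset (sX a); exact: VU.
Qed.

Let divX y := pderiv 0 (X 0) y + pderiv 1 (X 1) y.
Let H e y := pderiv 0 (fun y => cutoff e y * X 0 y) y +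
  pderiv 1 (fun y => cutoff e y * X 1 y) y.

Let smooth_H e : smooth_on_open (V e) (H e).
Proof. by apply: smoothD => //; exact: smooth_pderiv. Qed.

Let smooth_divX : smooth_on_open U divX.
Proof. by apply: smoothD => //; exact: smooth_pderiv. Qed.

Let integral_H e : 0 < e -> \int[mu]_(y in Q) H e y = 0.
Proof.
move=> e0.
have I a : mu.-integrable (Q : set RR) (EFin \o pderiv a (fun y => cutoff e y * X a y)).
  apply: (smooth_integrable cP open_open_polytope open_polytope_sub (PV e0)).
  exact: smooth_pderiv.
have Z a : \int[mu]_(y in Q) pderiv a (fun y => cutoff e y * X a y) y = 0.
  apply: (integral_pderiv_vanish cP open_open_polytope open_polytope_sub (PV e0)) => //.
  - exact: open_polytope_slice_fst.
  - exact: open_polytope_slice_snd.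
  - by move=> y Py nQ; rewrite /cutoff facet_prod_eq0// !mul0r.
rewrite RintegralD//; last by apply: open_measurable2; exact: open_open_polytope.
by rewrite !Z addr0.
Qed.

(** The gradient of p / (p + e) is e (p + e)^-2 grad p. Tangency turns X . grad p into p times the
    sum of the g_r, so p / (p + e) factors out of both terms. *)
Let HE e y : 0 < e -> Q y ->
  H e y = facet_prod y / (facet_prod y + e) *
    (divX y + e / (facet_prod y + e) * \sum_r g r y).
Proof.
move=> e0 Qy; have Vy : V e y by apply: PV => //; exact: open_polytope_sub.
have Uy := VU Vy; have d0 := den0 Vy.
have sp : smooth_on_open (V e) facet_prod by exact: smooth_facet_prod.
have sc : smooth_on_open (V e) (fun=> e) by exact: smooth_cst.
have sXV a : smooth_on_open (V e) (X a) by apply: smooth_subset (sX a); exact: VU.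
have dc a : pderiv a (cutoff e) y = e * (facet_prod y + e) ^- 2 * pderiv a facet_prod y.
  rewrite (pderivM a sp (smoothV (@openV e) (@smooth_den e) (@den0 e)) Vy).
  rewrite (pderivV a (@smooth_den e) Vy d0) (pderivD a sp sc Vy) pderiv_cst.
  by field.
rewrite /H !(pderivM _ (@smooth_cutoff e) (sXV _) Vy) !dc.
have := tangent_deriv_prod (index_enum 'I_N) Qy.
rewrite -/facet_prod -/(facet_prod y).
set G := \sum_r _; set p0 := pderiv 0 facet_prod y; set p1 := pderiv 1 facet_prod y.
set p := facet_prod y in d0 *; rewrite /cutoff -/p /divX => T.
transitivity (p / (p + e) * (pderiv 0 (X 0) y + pderiv 1 (X 1) y)
   + e * (p + e) ^- 2 * (X 0 y * p0 + X 1 y * p1)); first by ring.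
by rewrite T; field.
Qed.

(** Dominated convergence along e = 1 / (n + 1): every integral in the sequence is 0, and the
    integrands tend to [divX] pointwise on [Q]. *)
Theorem integral_divergence_tangent : \int[mu]_(y in Q) divX y = 0.
Proof.
pose G y := \sum_r g r y.
have sG : smooth_on_open U G by apply: smooth_sum.
have [M1 HM1] := smooth_bounded cP PU smooth_divX.
have [M2 HM2] := smooth_bounded cP PU sG.
have mQ : measurable (Q : set RR) by apply: open_measurable2; exact: open_open_polytope.
pose e n : R := n.+1%:R^-1.
have e0 n : 0 < e n by rewrite invr_gt0.
have ecvg : e n @[n --> \oo] --> (0 : R) by exact: cvg_harmonic.
have HEn n y : Q y -> H (e n) y = facet_prod y / (facet_prod y + e n) *
    (divX y + e n / (facet_prod y + e n) * G y) by exact: HE.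
(* Both p / (p + e) and e / (p + e) lie between 0 and 1, so the bounds of [divX] and [G] on [P] give
   a constant dominating function, integrable on the bounded set [Q]. *)
have Hbound n y : Q y -> `|H (e n) y| <= M1 + M2.
  move=> Qy; rewrite HEn//.
  have p0 := facet_prod_gt0 Qy.
  have Py := open_polytope_sub Qy.
  have d0 : 0 < facet_prod y + e n by exact: addr_gt0.
  rewrite normrM ger0_norm; last by rewrite divr_ge0// ltW.
  apply: (@le_trans _ _ (`|divX y + e n / (facet_prod y + e n) * G y|)).
    by rewrite ler_piMl// ler_pdivrMr// mul1r lerDl ltW.
  rewrite (le_trans (ler_normD _ _))// lerD//; first exact: HM1.
  apply: (le_trans _ (HM2 _ Py)).
  rewrite normrM ger0_norm; last by rewrite divr_ge0// ltW.
  by rewrite ler_piMl// ler_pdivrMr// mul1r lerDr ltW.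
have Hcvg y : Q y -> H (e n) y @[n --> \oo] --> divX y.
  move=> Qy; have p0 := facet_prod_gt0 Qy.
  have dc : (facet_prod y + e n)^-1 @[n --> \oo] --> (facet_prod y)^-1.
    apply: cvgV; first by rewrite gt_eqF.
    by rewrite -[X in _ --> X]addr0; apply: cvgD => //; exact: cvg_cst.
  have -> : (fun n => H (e n) y) = (fun n => facet_prod y * (facet_prod y + e n)^-1 *
    (divX y + e n * (facet_prod y + e n)^-1 * G y)).
    by apply/funext => n; rewrite HEn.
  rewrite [X in _ --> X](_ : _ = facet_prod y * (facet_prod y)^-1 *
      (divX y + 0 * (facet_prod y)^-1 * G y)); last first.
    by rewrite divff ?gt_eqF// !mul0r addr0 mul1r.
  have c1 : facet_prod y * (facet_prod y + e n)^-1 @[n --> \oo] -->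
      facet_prod y * (facet_prod y)^-1 by apply: cvgMr dc.
  have c2 : e n * (facet_prod y + e n)^-1 @[n --> \oo] --> 0 * (facet_prod y)^-1.
    exact: cvgM ecvg dc.
  have c3 : e n * (facet_prod y + e n)^-1 * G y @[n --> \oo]
      --> 0 * (facet_prod y)^-1 * G y by apply: cvgMl c2.
  have c4 : divX y + e n * (facet_prod y + e n)^-1 * G y @[n --> \oo]
      --> divX y + 0 * (facet_prod y)^-1 * G y by apply: cvgD c3; exact: cvg_cst.
  exact: cvgM c1 c4.
have iQ f : smooth_on_open U f -> mu.-integrable (Q : set RR) (EFin \o f).
  exact: polytope_smooth_integrable.
have mH n : measurable_fun (Q : set RR) (EFin \o H (e n) : RR -> \bar R).
  apply/measurable_EFinP; apply: continuous_measurable2; first exact: open_open_polytope.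
  move=> y /open_polytope_sub/(PV (e0 n)) Vy.
  exact: (smooth_continuous (@smooth_H (e n)) Vy).
have HcvgE y : Q y -> (H (e n) y)%:E @[n --> \oo] --> (divX y)%:E.
  move=> Qy; apply: cvg_EFin; first exact: nearW.
  exact: Hcvg.
have [|||||_ _ +] := @dominated_convergence _ _ _ (mu : measure _ _) Q mQ
  (fun n y => (H (e n) y)%:E) (fun y => (divX y)%:E) (fun=> (M1 + M2)%:E).
- exact: mH.
- exact: measurable_int _ (iQ _ smooth_divX).
- by apply: aeW => y; exact: HcvgE.
- exact: iQ _ (@smooth_cst _ _ oU _).
- by apply: aeW => y n Qy; rewrite lee_fin; exact: Hbound.
have iH n : (\int[mu]_(y in Q) (H (e n) y)%:E = 0)%E.
  have iHn := smooth_integrable cP open_open_polytope open_polytope_sub (PV (e0 n))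
    (@smooth_H (e n)).
  rewrite -(fineK (integrable_fin_num mQ iHn)).
  exact: (congr1 EFin (integral_H (e0 n))).
rewrite (_ : (fun n => _) = fun=> 0%E); last by apply/funext => n; exact: iH.
move=> /(cvg_unique (@ereal_hausdorff R) (cvg_cst _)) E.
by rewrite /Rintegral -E.
Qed.
End PolytopeGeometry.

(** * The Hessian of a symplectic potential and its inverse *)

Section SmoothLn.
Variable R : realType.
Implicit Types (U : set (R * R)) (f g : R * R -> R).

Lemma derivable_slice a f y :
  derivable (slice a f y) (axis_coord a y) 1 -> derivable f y (basis_vec R a).
Proof.
rewrite /derivable; set F := (X in X @ 0^' ) ; set G := (X in _ -> cvg (X @ 0^')).
by suff -> : G = F by []; apply/funext => h; congr (_ *: (_ - _));
 [exact: esym (slice_growth _ _ _ _)|exact: esym (slice_coord _ _ _)].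
Qed.

Lemma is_derive_ln_slice U f a y : smooth_on_open U f -> U y -> 0 < f y ->
  is_derive (axis_coord a y) 1 (slice a (fun z => ln (f z)) y) ((f y)^-1 * pderiv a f y).
Proof.
move=> sf Uy fy0.
have H1 := is_derive_slice a sf Uy.
have H2 : is_derive (slice a f y (axis_coord a y)) 1 (@ln R) (f y)^-1.
  by rewrite slice_coord; exact: is_derive1_ln.
exact: is_derive1_comp.
Qed.

Lemma pderiv_ln U f a y : smooth_on_open U f -> U y -> 0 < f y ->
  pderiv a (fun z => ln (f z)) y = (f y)^-1 * pderiv a f y.
Proof.
move=> sf Uy fy0; rewrite -slice_derive.
have H := is_derive_ln_slice a sf Uy fy0; exact: derive_val.
Qed.

(** One differentiation removes the logarithm: the derivative is f^-1 times a partial derivative of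
    f, smooth by the closure lemmas. Only continuity and the first derivative need an argument. *)
Lemma smooth_ln U f : open U -> smooth_on_open U f -> (forall y, U y -> 0 < f y) ->
  smooth_on_open U (fun z => ln (f z)).
Proof.
move=> oU sf f0 [|k] /=.
  move=> y; rewrite inE => Uy.
  apply: (@continuous_comp _ _ _ f (@ln R)); first exact: (smooth_continuous sf Uy).
  exact/continuous_ln/f0.
move=> a; split.
  move=> y Uy; apply: derivable_slice.
  have H := is_derive_ln_slice a sf Uy (f0 _ Uy); exact: ex_derive.
apply: (@Ck_on_ext _ _ _ (fun y => (f y)^-1 * pderiv a f y)) => //.
  by move=> y Uy; rewrite (pderiv_ln _ sf Uy (f0 _ Uy)).
apply: (smoothM oU); last exact: smooth_pderiv.
by apply: smoothV => // y Uy; rewrite gt_eqF// f0.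
Qed.

End SmoothLn.

Lemma hessE (R : realType) (f : R * R -> R) y a b :
  hess f y a b = pderiv b (pderiv a f) y.
Proof. exact: mxE. Qed.

Section Potential.
Variables (R : realType) (N : nat) (nu : 'I_N -> int * int) (c : 'I_N -> R).
Notation P := (polytope nu c).
Notation Q := (open_polytope nu c).
Notation l := (ell nu c).

Definition conormal (r : 'I_N) (a : 'I_2) : R :=
  if a == 0 then (nu r).1%:~R else (nu r).2%:~R.
Notation n := conormal.

Lemma pderiv_ellE a r y : pderiv a (l r) y = n r a.
Proof.
rewrite pderiv_ell /n /basis_vec; case: (a == 0) => /=.
  by rewrite mulr1 mulr0 addr0.
by rewrite mulr1 mulr0 add0r.
Qed.

Lemma pderiv_guillemin a y : Q y ->
  pderiv a (guillemin_potential nu c) y = \sum_r (n r a * ln (l r y) + n r a).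
Proof.
move=> Qy; have oQ := @open_open_polytope _ _ nu c.
have sl r : smooth_on_open Q (l r) by exact: smooth_ell.
have sln r : smooth_on_open Q (fun y => ln (l r y)) by apply: smooth_ln.
have sll r : smooth_on_open Q (fun y => l r y * ln (l r y)) by exact: smoothM.
rewrite /guillemin_potential.
elim: (index_enum _) => [|r s IH].
  rewrite [RHS]big_nil; apply: etrans (pderiv_cst a (0 : R) y).
  by congr (pderiv _ _ _); apply/funext => z; rewrite big_nil.
rewrite big_cons -IH.
have ss : smooth_on_open Q (fun y => \sum_(r <- s) l r y * ln (l r y)).
  exact: smooth_sum.
have -> : (fun y => \sum_(j <- r :: s) l j y * ln (l j y)) =
    (fun y => l r y * ln (l r y) + \sum_(j <- s) l j y * ln (l j y)).
  by apply/funext => z; rewrite big_cons.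
rewrite (pderivD _ (sll r) ss Qy); congr (_ + _).
rewrite (pderivM _ (sl r) (sln r) Qy) (pderiv_ln _ (sl r) Qy (Qy r)) pderiv_ellE.
by rewrite mulVKf ?gt_eqF// addrC mulrC.
Qed.

Lemma pderiv2_guillemin a b y : Q y ->
  pderiv b (pderiv a (guillemin_potential nu c)) y = \sum_r n r a * n r b / l r y.
Proof.
move=> Qy; have oQ := @open_open_polytope _ _ nu c.
rewrite (pderiv_near b oQ Qy (pderiv_guillemin a)).
have sl r : smooth_on_open Q (l r) by exact: smooth_ell.
have sln r : smooth_on_open Q (fun y => ln (l r y)) by apply: smooth_ln.
have scn d : smooth_on_open Q (fun=> d) by exact: smooth_cst.
have snl r : smooth_on_open Q (fun y => n r a * ln (l r y)) by exact: smoothM.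
have sll r : smooth_on_open Q (fun y => n r a * ln (l r y) + n r a) by exact: smoothD.
elim: (index_enum _) => [|r s IH].
  rewrite [RHS]big_nil; apply: etrans (pderiv_cst b (0 : R) y).
  by congr (pderiv _ _ _); apply/funext => z; rewrite big_nil.
rewrite big_cons -IH.
have ss : smooth_on_open Q (fun y => \sum_(r <- s) (n r a * ln (l r y) + n r a)).
  exact: smooth_sum.
have -> : (fun y => \sum_(j <- r :: s) (n j a * ln (l j y) + n j a)) =
    (fun y => (n r a * ln (l r y) + n r a) + \sum_(j <- s) (n j a * ln (l j y) + n j a)).
  by apply/funext => z; rewrite big_cons.
rewrite (pderivD _ (sll r) ss Qy); congr (_ + _).
rewrite (pderivD _ (snl r) (scn (n r a)) Qy) pderiv_cst addr0.
rewrite (pderivM _ (scn (n r a)) (sln r) Qy) pderiv_cst mulr0 addr0.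
by rewrite (pderiv_ln _ (sl r) Qy (Qy r)) pderiv_ellE mulrCA mulrC.
Qed.

Variables (u h : R * R -> R) (U : set (R * R)).
Hypotheses (PU : P `<=` U) (sh : smooth_on_open U h).
Hypothesis uE : forall y, P y -> u y = guillemin_potential nu c y + h y.

(** The formula for [u] is known on [P] only, which is enough on the open set [Q], where every l^r
    is positive and the Guillemin potential is smooth. *)
Lemma hess_potential a b y : Q y ->
  hess u y a b = (\sum_r n r a * n r b / l r y) + hess h y a b.
Proof.
move=> Qy; apply: (etrans (hessE u y a b)).
apply: etrans (congr1 (GRing.add _) (esym (hessE h y a b))).
have oQ := @open_open_polytope _ _ nu c.
have QU : Q `<=` U by move=> z Qz; exact/PU/open_polytope_sub.
have shQ : smooth_on_open Q h by exact: smooth_subset sh.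
have sl r : smooth_on_open Q (l r) by exact: smooth_ell.
have sg : smooth_on_open Q (guillemin_potential nu c).
  by apply: smooth_sum => // r _; apply: smoothM => //; exact: smooth_ln.
have E1 z : Q z -> pderiv a u z =
    pderiv a (guillemin_potential nu c) z + pderiv a h z.
  move=> Qz; rewrite -(pderivD a sg shQ Qz); apply: (pderiv_near a oQ Qz) => w Qw.
  by rewrite uE//; exact: open_polytope_sub.
rewrite (pderiv_near b oQ Qy E1).
rewrite (pderivD b (smooth_pderiv a sg) (smooth_pderiv a shQ) Qy).
by rewrite pderiv2_guillemin.
Qed.

End Potential.

Lemma sum_ord2 (V : nmodType) (F : 'I_2 -> V) : \sum_a F a = F 0 + F 1.
Proof. by rewrite big_ord_recl big_ord1; congr (_ + F _); apply: val_inj. Qed.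

(** * Adjugate and determinant of the Hessian with denominators cleared *)

Section Inverse.
Variables (R : realType) (N : nat) (nu : 'I_N -> int * int) (c : 'I_N -> R).
Notation P := (polytope nu c).
Notation Q := (open_polytope nu c).
Notation l := (ell nu c).
Notation n := (conormal R nu).
Notation p := (facet_prod nu c).

(** The adjugate, on index functions instead of matrices: each entry is then a scalar function, to
    which the smoothness lemmas apply. *)
Definition adj2 (M : 'I_2 -> 'I_2 -> R) (a b : 'I_2) : R :=
  if a == 0 then (if b == 0 then M 1 1 else - M 0 1)
  else (if b == 0 then - M 1 0 else M 0 0).

(** The conormal after a quarter turn, a direction along the facet. The adjugate of nu_r nu_r^T is
    the outer square of this vector, which is orthogonal to nu_r. *)
Definition rotated (r : 'I_N) (a : 'I_2) : R := if a == 0 then n r 1 else - n r 0.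

Definition facet_prod1 (r : 'I_N) (y : R * R) : R := \prod_(s | s != r) l s y.
Definition facet_prod2 (r s : 'I_N) (y : R * R) : R :=
  \prod_(t | (t != r) && (t != s)) l t y.

Lemma facet_prodE r y : p y = l r y * facet_prod1 r y.
Proof. by rewrite /facet_prod (bigD1 r). Qed.

Lemma facet_prod1E r s y : s != r -> facet_prod1 r y = l s y * facet_prod2 r s y.
Proof. by move=> sr; rewrite /facet_prod1 (bigD1 s)//=. Qed.

(* As adj is linear on 2x2 matrices, this is p * adj (sum_r nu_r nu_r^T / l^r + m)
   with the denominators cleared; see adjGE. *)
Definition adjG (m : 'I_2 -> 'I_2 -> R) (y : R * R) (a b : 'I_2) : R :=
  (\sum_r facet_prod1 r y * (rotated r a * rotated r b)) + p y * adj2 m a b.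

(* p * det (sum_r nu_r nu_r^T / l^r + m) with the denominators cleared: the
   diagonal terms, which would have 1 / (l^r)^2, cancel; see detGE. *)
Definition detG (m : 'I_2 -> 'I_2 -> R) (y : R * R) : R :=
  (\sum_r \sum_(s | s != r)
     facet_prod2 r s y * (n r 0 ^+ 2 * n s 1 ^+ 2 - n r 0 * n r 1 * n s 0 * n s 1))
  + (\sum_r facet_prod1 r y * (n r 0 ^+ 2 * m 1 1 + n r 1 ^+ 2 * m 0 0
       - n r 0 * n r 1 * (m 0 1 + m 1 0)))
  + p y * (m 0 0 * m 1 1 - m 0 1 * m 1 0).

Variables (m g : 'I_2 -> 'I_2 -> R) (y : R * R).
Hypothesis Qy : Q y.
Hypothesis gE : forall a b, g a b = (\sum_r n r a * n r b / l r y) + m a b.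

Lemma facet_prod_mulV r : facet_prod1 r y = p y / l r y.
Proof. by rewrite (facet_prodE r) mulrC mulKf// gt_eqF. Qed.

Lemma facet_prod2_mulV r s : s != r -> facet_prod2 r s y = p y / l r y / l s y.
Proof.
by move=> sr; rewrite -facet_prod_mulV// (facet_prod1E _ sr) mulrC mulKf// gt_eqF.
Qed.

Lemma adjGE a b : adjG m y a b = p y * adj2 g a b.
Proof.
rewrite /adjG.
under eq_bigr => r _ do rewrite facet_prod_mulV// -mulrA.
rewrite -mulr_sumr -mulrDr; congr (_ * _).
rewrite /adj2 /rotated; case: (a == 0); case: (b == 0);
  rewrite gE ?opprD -?sumrN;
  by congr (_ + _); apply: eq_bigr => r _; ring.
Qed.

Lemma detGE : detG m y = p y * (g 0 0 * g 1 1 - g 0 1 * g 1 0).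
Proof.
rewrite !gE /detG.
set h00 := m 0 0; set h01 := m 0 1; set h10 := m 1 0; set h11 := m 1 1.
under eq_bigr => r _.
  under eq_bigr => s sr do rewrite facet_prod2_mulV// -!mulrA.
  rewrite -mulr_sumr; over.
under [X in _ + X + _]eq_bigr => r _ do rewrite facet_prod_mulV// -mulrA.
rewrite -!mulr_sumr -!mulrDr; congr (_ * _).
set S := fun a b => \sum_r n r a * n r b / l r y.
(* The determinant of S + m is expanded as det S, plus the mixed bilinear term, plus det m. *)
transitivity ((S 0 0 * S 1 1 - S 0 1 * S 1 0)
  + (S 0 0 * h11 + S 1 1 * h00 - S 0 1 * h10 - S 1 0 * h01)
  + (h00 * h11 - h01 * h10)); last by rewrite /S; ring.
congr (_ + _ + _).
  rewrite /S !mulr_suml -sumrB; apply: eq_bigr => r _.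
  rewrite !mulr_sumr -sumrB [RHS](bigD1 r)//=.
  (* The term s = r is the determinant of a rank-one matrix. *)
  rewrite [X in _ = X + _](_ : _ = 0) ?add0r; last by ring.
  by apply: eq_bigr => s _; ring.
rewrite /S !mulr_suml -big_split -!sumrB /=; apply: eq_bigr => r _; ring.
Qed.

End Inverse.

Section InverseSmooth.
Variables (R : realType) (N : nat) (nu : 'I_N -> int * int) (c : 'I_N -> R).
Notation P := (polytope nu c).
Notation Q := (open_polytope nu c).
Notation l := (ell nu c).
Notation n := (conormal R nu).
Notation p := (facet_prod nu c).

Definition adjG_conormal (m : 'I_2 -> 'I_2 -> R) (y : R * R) (r : 'I_N) (a : 'I_2) : R :=
  (\sum_(s | s != r) facet_prod2 nu c s r y *
     (rotated R nu s a * (\sum_b rotated R nu s b * n r b)))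
  + facet_prod1 nu c r y * (\sum_b adj2 m a b * n r b).

(** In the sum over s, the term s = r dies because the rotated conormal is orthogonal to nu_r; every
    other term contains the factor l^r, as does p. The quotient [adjG_conormal], divided by D, is
    the smooth k_r. *)
Lemma adjG_mul_conormal m y r a :
  \sum_b adjG nu c m y a b * n r b = l r y * adjG_conormal m y r a.
Proof.
transitivity (\sum_s facet_prod1 nu c s y *
    (rotated R nu s a * (\sum_b rotated R nu s b * n r b))
  + p y * \sum_b adj2 m a b * n r b).
  rewrite /adjG; under eq_bigr => b _ do rewrite mulrDl mulr_suml.
  rewrite big_split /= exchange_big /=; congr (_ + _).
    apply: eq_bigr => s _; rewrite !mulr_sumr; apply: eq_bigr => b _; ring.
  by rewrite mulr_sumr; apply: eq_bigr => b _; rewrite mulrA.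
rewrite (facet_prodE _ _ r) /adjG_conormal mulrDr mulrA; congr (_ + _).
rewrite (bigD1 r)//= [X in X + _](_ : _ = 0) ?add0r; last first.
  by rewrite sum_ord2 /rotated /=; ring.
rewrite mulr_sumr; apply: eq_bigr => s sr.
by rewrite (@facet_prod1E _ _ nu c s r) ?(eq_sym r)// -mulrA.
Qed.

Lemma adjG_sym (m : 'I_2 -> 'I_2 -> R) y a b : (forall a b, m a b = m b a) ->
  adjG nu c m y a b = adjG nu c m y b a.
Proof.
move=> ms; rewrite /adjG; congr (_ + _ * _).
  by apply: eq_bigr => r _; rewrite [rotated _ _ _ a * _]mulrC.
by rewrite /adj2; case: (a == 0); case: (b == 0) => //; rewrite ms.
Qed.

Variables (U : set (R * R)) (oU : open U) (m : R * R -> 'I_2 -> 'I_2 -> R).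
Hypothesis sm : forall a b, smooth_on_open U (fun y => m y a b).

Lemma smooth_facet_prod1 r : smooth_on_open U (facet_prod1 nu c r).
Proof. by apply: smooth_prod => // s _; exact: smooth_ell. Qed.

Lemma smooth_facet_prod2 r s : smooth_on_open U (facet_prod2 nu c r s).
Proof. by apply: smooth_prod => // t _; exact: smooth_ell. Qed.

Lemma smooth_adj2 a b : smooth_on_open U (fun y => adj2 (m y) a b).
Proof.
by rewrite /adj2; case: (a == 0); case: (b == 0); do ?[exact: sm|apply: smoothN].
Qed.

Lemma smooth_adjG a b : smooth_on_open U (fun y => adjG nu c (m y) y a b).
Proof.
apply: (smoothD oU); last first.
  by apply: (smoothM oU); [exact: smooth_facet_prod|exact: smooth_adj2].
apply: (smooth_sum oU) => r _; apply: (smoothM oU); last exact: smooth_cst.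
exact: smooth_facet_prod1.
Qed.

Lemma smooth_adjG_conormal r a : smooth_on_open U (fun y => adjG_conormal (m y) y r a).
Proof.
apply: (smoothD oU).
  apply: (smooth_sum oU) => s _; apply: (smoothM oU); last exact: smooth_cst.
  exact: smooth_facet_prod2.
apply: (smoothM oU); first exact: smooth_facet_prod1.
apply: (smooth_sum oU) => b _; apply: (smoothM oU); last exact: smooth_cst.
exact: smooth_adj2.
Qed.

Lemma smooth_detG : smooth_on_open U (fun y => detG nu c (m y) y).
Proof.
apply: (smoothD oU); first apply: (smoothD oU).
- apply: (smooth_sum oU) => r _; apply: (smooth_sum oU) => s _.
  by apply: (smoothM oU); [exact: smooth_facet_prod2|exact: smooth_cst].
- apply: (smooth_sum oU) => r _; apply: (smoothM oU); first exact: smooth_facet_prod1.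
  apply: (smoothB oU); first apply: (smoothD oU).
  + by apply: (smoothM oU); [exact: smooth_cst|exact: sm].
  + by apply: (smoothM oU); [exact: smooth_cst|exact: sm].
  + apply: (smoothM oU); first exact: smooth_cst.
    by apply: (smoothD oU); exact: sm.
- apply: (smoothM oU); first exact: smooth_facet_prod.
  by apply: (smoothB oU); apply: (smoothM oU); exact: sm.
Qed.

End InverseSmooth.

Lemma smooth_hess (R : realType) (U : set (R * R)) (h : R * R -> R) a b : open U ->
  smooth_on_open U h -> smooth_on_open U (fun y => hess h y a b).
Proof.
move=> oU sh; apply: (@smooth_ext _ _ (pderiv b (pderiv a h))) => //.
  by move=> y _; apply: esym (hessE _ _ _ _).
by do 2!apply: smooth_pderiv.
Qed.

Lemma hess_sym (R : realType) (U : set (R * R)) (h : R * R -> R) y a b : open U ->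
  smooth_on_open U h -> U y -> hess h y a b = hess h y b a.
Proof.
move=> oU sh Uy; apply: etrans (hessE _ _ _ _) _.
by apply: etrans (esym (hessE _ _ _ _)); exact: schwarz oU sh Uy.
Qed.

Lemma det_mx2 (R : comNzRingType) (M : 'M[R]_2) :
  \det M = M 0 0 * M 1 1 - M 0 1 * M 1 0.
Proof.
rewrite (expand_det_row _ 0) sum_ord2 /cofactor !det_mx11 !mxE /=.
have E0 : lift 0 0 = 1 :> 'I_2 by apply: val_inj.
have E1 : lift 1 0 = 0 :> 'I_2 by apply: val_inj.
by rewrite E0 E1 expr0 expr1 mul1r mulN1r mulrN.
Qed.

Lemma invmx2 (F : fieldType) (M B : 'M[F]_2) :  B *m M = 1%:M -> invmx M = B.
Proof.
move=> BM; have [_ uM] := mulmx1_unit BM.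
by rewrite -[LHS]mul1mx -BM mulmxK.
Qed.

Lemma posdef_diag (R : realType) (M : 'M[R]_2) a : posdef M -> 0 < M a a.
Proof.
move=> /(_ (delta_mx a 0)); rewrite trmx_delta -rowE -colE !mxE; apply.
by apply/eqP => /matrixP/(_ a 0); rewrite !mxE !eqxx => /eqP; rewrite oner_eq0.
Qed.

(** * Smooth extension of the inverse Hessian to a neighbourhood of the polytope *)

Section InverseHessian.
Variables (R : realType) (N : nat) (nu : 'I_N -> int * int) (c : 'I_N -> R).
Notation P := (polytope nu c).
Notation Q := (open_polytope nu c).
Notation l := (ell nu c).
Notation n := (conormal R nu).
Notation p := (facet_prod nu c).

Lemma ell_segment r y0 y1 (t : R) :
  l r (y0.1 + t * (y1.1 - y0.1), y0.2 + t * (y1.2 - y0.2)) =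
  (1 - t) * l r y0 + t * l r y1.
Proof. by rewrite /ell /=; ring. Qed.

(** Moving slightly from [y] towards [y0] makes each l^r a convex combination with positive weight
    on a positive value. So [Q] is dense in [P]. *)
Lemma polytope_approx y0 y (B : set (R * R)) : Q y0 -> P y -> nbhs y B ->
  exists2 z, Q z & B z.
Proof.
move=> Qy0 Py /nbhs_ballP[e /= e0 eB].
set d1 := `|y0.1 - y.1|; set d2 := `|y0.2 - y.2|.
have d10 : 0 <= d1 by exact: normr_ge0.
have d20 : 0 <= d2 by exact: normr_ge0.
(* The denominator exceeds each of e, d1 and d2, which gives t < 1 and displacements t * d1 and t *
   d2 below e. *)
pose t := e / (1 + e + d1 + d2).
have den0 : 0 < 1 + e + d1 + d2 by lra.
have t0 : 0 < t by exact: divr_gt0.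
have t1 : t < 1 by rewrite ltr_pdivrMr// mul1r; lra.
have td1 : t * d1 < e by rewrite mulrAC ltr_pdivrMr// ltr_pM2l//; lra.
have td2 : t * d2 < e by rewrite mulrAC ltr_pdivrMr// ltr_pM2l//; lra.
exists (y.1 + t * (y0.1 - y.1), y.2 + t * (y0.2 - y.2)).
  move=> r; rewrite ell_segment ltr_wpDl//; last exact: mulr_gt0.
  by rewrite mulr_ge0// subr_ge0 ltW.
by apply: eB; split; rewrite /ball /= opprD addNKr normrN normrM gtr0_norm.
Qed.

(** If D vanished at a point of [P], the product of D and delta would have absolute value below 1 on
    the nearby points of [P]; some of those lie in [Q], where it equals 1. *)
Lemma extends_nonzero (D delta : R * R -> R) y0 : Q y0 ->
  (forall y, P y -> {for y, continuous D}) ->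
  {within P, continuous delta} ->
  (forall y, Q y -> D y * delta y = 1) -> forall y, P y -> D y != 0.
Proof.
move=> Qy0 cD /subspace_continuousP cdelta Ddelta y Py; apply/negP => /eqP Dy0.
have c1 : D z * delta z @[z --> within P (nbhs y)] --> D y * delta y.
  by apply: cvgM; [apply: cvg_within_filter; exact: cD|exact: cdelta].
rewrite Dy0 mul0r in c1.
have /cvgr0_norm_lt/(_ 1 ltr01) nb := c1.
have [z Qz /(_ (open_polytope_sub Qz))] := polytope_approx Qy0 Py nb.
by rewrite Ddelta// normr1 ltxx.
Qed.

Lemma adj2_det (m : 'I_2 -> 'I_2 -> R) (d : R) : d != 0 ->
  d = m 0 0 * m 1 1 - m 0 1 * m 1 0 ->
  adj2 m 0 0 / d * (adj2 m 1 1 / d) - adj2 m 0 1 / d * (adj2 m 1 0 / d) = d^-1.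
Proof.
rewrite /adj2 /=; move: (m 0 0) (m 0 1) (m 1 0) (m 1 1) => a b b' e d0 dE.
transitivity ((a * e - b * b') / d / d); first by ring.
by rewrite -dE divff// mul1r.
Qed.

(** [H] is adjG / D and [k] is adjG_conormal / D. The last two inequalities are Sylvester's
    criterion for [H], the form in which positivity of the trace uses it. *)
Lemma inverse_hessian (u : R * R -> R) : delzant nu c -> symplectic_potential nu c u ->
  exists (U : set (R * R)) (H : 'I_2 -> 'I_2 -> R * R -> R)
         (k : 'I_N -> 'I_2 -> R * R -> R),
    [/\ open U, P `<=` U,
        (forall a b, smooth_on_open U (H a b)) /\
        (forall r a, smooth_on_open U (k r a)),
        (forall y a b, U y -> H a b y = H b a y) /\
        (forall y r a, U y -> \sum_b H a b y * n r b = l r y * k r a y)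
      & forall y, Q y ->
        [/\ hess u y \in unitmx,
            invmx (hess u y) = \matrix_(a, b) H a b y,
            0 < H 0 0 y & 0 < H 0 0 y * H 1 1 y - H 0 1 y * H 1 0 y]].
Proof.
move=> [cP [y0 Py0] _ coP _] [[h [U0 [h' [oU0 PU0 sh' hh']]] uE] pd [delta [cdelta delta0 detu]]].
have PQ := interior_polytope c coP; rewrite PQ in Py0 pd detu.
have uE' y : P y -> u y = guillemin_potential nu c y + h' y.
  by move=> Py; rewrite uE// hh'.
pose m y a b := hess h' y a b.
have sm a b : smooth_on_open U0 (fun y => m y a b) by exact: smooth_hess.
pose D y := detG nu c (m y) y.
have sD : smooth_on_open U0 D by exact: smooth_detG.
have gE y : Q y -> forall a b, hess u y a b = \sum_r n r a * n r b / l r y + m y a b.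
  by move=> Qy a b; refine (hess_potential PU0 sh' uE' a b Qy).
have DE y : Q y -> D y = p y * \det (hess u y).
  by move=> Qy; rewrite det_mx2; exact: (detGE Qy (gE y Qy)).
have detgt0 y : Q y -> 0 < \det (hess u y).
  move=> Qy; rewrite detu// invr_gt0 mulr_gt0 ?delta0//; first exact: open_polytope_sub.
  exact: facet_prod_gt0.
(* On [Q], D is p times the determinant of the Hessian, so Guillemin's condition says that D times
   delta is 1. *)
have D0 : forall y, P y -> D y != 0.
  apply: (extends_nonzero Py0 _ cdelta).
    by move=> y /PU0 Uy; exact: (smooth_continuous sD Uy).
  move=> y Qy; rewrite DE// detu//.
  have p0 : p y != 0 by rewrite gt_eqF// facet_prod_gt0.
  have d0 : delta y != 0 by rewrite gt_eqF// delta0//; exact: open_polytope_sub.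
  by rewrite -/(facet_prod nu c y) invfM mulrCA mulrAC mulrA mulVf// mul1r mulfV.
(* The domain of the extension of [h] is shrunk to where D is invertible; it still contains [P]. *)
pose U := U0 `&` [set y | D y != 0].
have UU0 : U `<=` U0 by move=> y [].
have oU : open U.
  rewrite openE => y [Uy Dy]; apply: filterI; first exact: open_nbhs_nbhs.
  have cD := smooth_continuous sD Uy.
  have nD : nbhs (D y) [set x : R | x != 0].
    by apply: open_nbhs_nbhs; split => //; exact: open_neq.
  exact: cD nD.
have sDU : smooth_on_open U D by exact: smooth_subset sD.
have smU a b : smooth_on_open U (fun y => m y a b) by exact: smooth_subset (sm a b).
have sDV : smooth_on_open U (fun y => (D y)^-1) by apply: smoothV => // y [].
exists U, (fun a b y => adjG nu c (m y) y a b * (D y)^-1),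
  (fun r a y => adjG_conormal nu c (m y) y r a * (D y)^-1).
have ms y : U y -> forall a b, m y a b = m y b a.
  by move=> /UU0 Uy a b; exact: hess_sym oU0 sh' Uy.
split=> //.
- by move=> y Py; split; [exact: PU0|exact: D0].
- split=> [a b|r a]; apply: (smoothM oU) => //; first exact: smooth_adjG.
  exact: smooth_adjG_conormal.
- split=> [y a b Uy|y r a Uy]; first by congr (_ * _); exact: adjG_sym (ms y Uy).
  rewrite mulrA -adjG_mul_conormal mulr_suml; apply: eq_bigr => b _.
  by rewrite mulrAC.
move=> y Qy; set g := hess u y.
have dg : 0 < \det g by exact: detgt0.
have p0 : 0 < p y by exact: facet_prod_gt0.
have HE a b : adjG nu c (m y) y a b * (D y)^-1 = adj2 g a b / \det g.
  rewrite (adjGE Qy (gE y Qy)) DE// invfM mulrACA divff ?gt_eqF//.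
  exact: mul1r.
have ug : g \in unitmx by rewrite unitmxE unitfE gt_eqF.
have pdg := pd y Qy.
have E00 : adj2 g 0 0 = g 1 1 by [].
split=> //.
- apply: invmx2; apply/matrixP => a b; rewrite mxE sum_ord2 [X in X * _ + _]mxE.
  rewrite [X in _ + X * _]mxE !HE [RHS]mxE.
  have -> : adj2 g a 0 / \det g * g 0 b + adj2 g a 1 / \det g * g 1 b =
    (adj2 g a 0 * g 0 b + adj2 g a 1 * g 1 b) / \det g by ring.
  have -> : adj2 g a 0 * g 0 b + adj2 g a 1 * g 1 b = (a == b)%:R * \det g.
    rewrite det_mx2 /adj2; move: a b; apply: ord2P; apply: ord2P => /=; ring.
  by rewrite mulfK// gt_eqF.
- by rewrite HE E00 divr_gt0//; exact: posdef_diag.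
by rewrite !HE adj2_det ?invr_gt0 ?gt_eqF//; exact: det_mx2.
Qed.

End InverseHessian.

(** * Integration by parts *)

(** [F1] and [F2] stand for the derivatives of f, [M1] and [M2] for those of M with the directions
    of differentiation as leading indices. T a b is the a-derivative of M^{ab} f_{,b} - f
    (M^{ba})_{,b}; the terms with first derivatives of both f and M cancel under exchange of a and
    b. *)
Lemma divergence_algebra (R : comRingType) (M F2 : 'I_2 -> 'I_2 -> R) (f : R)
    (F1 : 'I_2 -> R) (M1 : 'I_2 -> 'I_2 -> 'I_2 -> R)
    (M2 : 'I_2 -> 'I_2 -> 'I_2 -> 'I_2 -> R) :
  let T a b := M a b * F2 a b + F1 b * M1 a a b
    - (f * M2 a b b a + M1 b b a * F1 a) in
  (T 0 0 + T 0 1) + (T 1 0 + T 1 1) =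
  (\sum_a \sum_b M a b * F2 a b) - f * (\sum_a \sum_b M2 b a a b).
Proof. by rewrite /= !sum_ord2; ring. Qed.

(** Contracting nu_r with M gives l V on one side and l B on the other. Differentiating l B leaves a
    term B . n without the factor l, but it comes from contracting M with nu_r twice and is again
    divisible by l. *)
Lemma tangency_algebra (R : comRingType) (M D1 : 'I_2 -> 'I_2 -> R) (f l kk : R)
    (F1 n V B dB : 'I_2 -> R) :
  (forall b, n 0 * M 0 b + n 1 * M 1 b = l * V b) ->
  (forall b, n 0 * D1 b 0 + n 1 * D1 b 1 = l * dB b + B b * n b) ->
  \sum_b B b * n b = l * kk ->
  n 0 * ((M 0 0 * F1 0 - f * D1 0 0) + (M 0 1 * F1 1 - f * D1 1 0))
  + n 1 * ((M 1 0 * F1 0 - f * D1 0 1) + (M 1 1 * F1 1 - f * D1 1 1)) =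
  l * ((\sum_b V b * F1 b) - f * (kk + \sum_b dB b)).
Proof.
rewrite !sum_ord2 => HV HB HK.
transitivity ((n 0 * M 0 0 + n 1 * M 1 0) * F1 0 + (n 0 * M 0 1 + n 1 * M 1 1) * F1 1
  - f * ((n 0 * D1 0 0 + n 1 * D1 0 1) + (n 0 * D1 1 0 + n 1 * D1 1 1))); first by ring.
rewrite !HV !HB.
transitivity (l * V 0 * F1 0 + l * V 1 * F1 1
  - f * (l * dB 0 + l * dB 1 + (B 0 * n 0 + B 1 * n 1))); first by ring.
by rewrite HK; ring.
Qed.

Section ByParts.
Variables (R : realType) (N : nat) (nu : 'I_N -> int * int) (c : 'I_N -> R).
Notation P := (polytope nu c).
Notation Q := (open_polytope nu c).
Notation l := (ell nu c).
Notation n := (conormal R nu).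
Notation RR := (measurableTypeR R * measurableTypeR R)%type.
Notation mu := (@leb2 R).
Hypothesis cP : compact P.
Variables (U : set (R * R)) (H A : 'I_2 -> 'I_2 -> R * R -> R)
  (k : 'I_N -> 'I_2 -> R * R -> R).
Hypotheses (oU : open U) (PU : P `<=` U).
Hypotheses (sH : forall a b, smooth_on_open U (H a b))
  (sA : forall a b, smooth_on_open U (A a b))
  (sk : forall r a, smooth_on_open U (k r a)).
Hypothesis Hsym : forall y a b, U y -> H a b y = H b a y.
Hypothesis Hk : forall y r a, U y -> \sum_b H a b y * n r b = l r y * k r a y.

Definition conj_by a b (y : R * R) : R :=
  \sum_i \sum_j H a i y * A i j y * H j b y.
Notation M := conj_by.

Lemma smooth_conj_by a b : smooth_on_open U (M a b).
Proof.
apply: (smooth_sum oU) => i _; apply: (smooth_sum oU) => j _.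
by apply: (smoothM oU) => //; exact: (smoothM oU).
Qed.
Let sM := smooth_conj_by.

Definition divdiv_conj y := \sum_a \sum_b pderiv b (pderiv a (M a b)) y.

Lemma smooth_divdiv_conj : smooth_on_open U divdiv_conj.
Proof.
apply: (smooth_sum oU) => i _; apply: (smooth_sum oU) => j _.
by do 2!apply: smooth_pderiv; exact: sM.
Qed.

(** In H A H, one or both outer factors H are replaced by k_r: these are the quotients by l^r left
    after contracting with nu_r on the left, on the right, or on both sides. *)
Let V r b y := \sum_i \sum_j k r i y * A i j y * H j b y.
Let B r b y := \sum_i \sum_j H b i y * A i j y * k r j y.
Let kk r y := \sum_i \sum_j k r i y * A i j y * k r j y.

Let sV r b : smooth_on_open U (V r b).
Proof.
apply: (smooth_sum oU) => i _; apply: (smooth_sum oU) => j _.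
by apply: (smoothM oU) => //; exact: (smoothM oU).
Qed.

Let sB r b : smooth_on_open U (B r b).
Proof.
apply: (smooth_sum oU) => i _; apply: (smooth_sum oU) => j _.
by apply: (smoothM oU) => //; exact: (smoothM oU).
Qed.

Let skk r : smooth_on_open U (kk r).
Proof.
apply: (smooth_sum oU) => i _; apply: (smooth_sum oU) => j _.
by apply: (smoothM oU) => //; exact: (smoothM oU).
Qed.

Let Hk' y r b : U y -> \sum_a n r a * H a b y = l r y * k r b y.
Proof.
by move=> Uy; rewrite -Hk//; apply: eq_bigr => a _; rewrite mulrC Hsym.
Qed.

Let MV y r b : U y -> n r 0 * M 0 b y + n r 1 * M 1 b y = l r y * V r b y.
Proof.
move=> Uy; rewrite -(sum_ord2 (fun a => n r a * M a b y)).
under eq_bigr => a _ do (rewrite /M mulr_sumr; under eq_bigr => i _ do rewrite mulr_sumr).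
rewrite exchange_big /V mulr_sumr; apply: eq_bigr => i _ /=.
rewrite exchange_big mulr_sumr; apply: eq_bigr => j _ /=.
rewrite !mulrA -Hk'// !mulr_suml; apply: eq_bigr => a _; by rewrite !mulrA.
Qed.

Let MB y r b : U y -> n r 0 * M b 0 y + n r 1 * M b 1 y = l r y * B r b y.
Proof.
move=> Uy; rewrite -(sum_ord2 (fun a => n r a * M b a y)).
under eq_bigr => a _ do (rewrite /M mulr_sumr; under eq_bigr => i _ do rewrite mulr_sumr).
rewrite exchange_big /B mulr_sumr; apply: eq_bigr => i _ /=.
rewrite exchange_big mulr_sumr; apply: eq_bigr => j _ /=.
rewrite [RHS]mulrCA -Hk// mulr_sumr; apply: eq_bigr => a _; by rewrite mulrC mulrA.
Qed.

Let Bn y r : U y -> \sum_b B r b y * n r b = l r y * kk r y.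
Proof.
move=> Uy.
under eq_bigr => a _ do (rewrite /B mulr_suml; under eq_bigr => i _ do rewrite mulr_suml).
rewrite exchange_big /kk mulr_sumr; apply: eq_bigr => i _ /=.
rewrite exchange_big mulr_sumr; apply: eq_bigr => j _ /=.
rewrite !mulrA -Hk'// !mulr_suml; apply: eq_bigr => a _.
by rewrite mulrC !mulrA.
Qed.

(** This differentiates [MB], an identity on the whole open set [U]; the last term comes from the
    gradient of l^r, which is nu_r. *)
Let dMB y r b : U y -> n r 0 * pderiv b (M b 0) y + n r 1 * pderiv b (M b 1) y =
  l r y * pderiv b (B r b) y + B r b y * n r b.
Proof.
move=> Uy.
have scn a : smooth_on_open U (fun=> n r a) by exact: smooth_cst.
have sl : smooth_on_open U (l r) by exact: smooth_ell.
have s1 a : smooth_on_open U (fun z => n r a * M b a z).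
  by apply: (smoothM oU) => //; exact: sM.
have E a : pderiv b (fun z => n r a * M b a z) y = n r a * pderiv b (M b a) y.
  by rewrite (pderivM b (scn a) (sM b a) Uy) pderiv_cst mulr0 addr0.
rewrite -!E -(pderivD b (s1 0) (s1 1) Uy).
rewrite (pderiv_near b oU Uy (fun z Uz => MB r b Uz)).
by rewrite (pderivM b sl (sB r b) Uy) pderiv_ellE.
Qed.

Variable f : R * R -> R.
Hypothesis sf : smooth_on_open U f.

Let term a b y := M a b y * pderiv b f y - f y * pderiv b (M b a) y.
Let X a y := term a 0 y + term a 1 y.
Let g r y := (\sum_b V r b y * pderiv b f y)
  - f y * (kk r y + \sum_b pderiv b (B r b) y).

Let sterm a b : smooth_on_open U (term a b).
Proof.
by apply: (smoothB oU); apply: (smoothM oU) => //; exact: smooth_pderiv.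
Qed.

Let sX a : smooth_on_open U (X a).
Proof. exact: (smoothD oU). Qed.

Let sg r : smooth_on_open U (g r).
Proof.
apply: (smoothB oU).
  apply: (smooth_sum oU) => b _; apply: (smoothM oU) => //; exact: smooth_pderiv.
apply: (smoothM oU) => //; apply: (smoothD oU) => //.
by apply: (smooth_sum oU) => b _; apply: smooth_pderiv; exact: sB.
Qed.

Let Xg r y : Q y ->
  (nu r).1%:~R * X 0 y + (nu r).2%:~R * X 1 y = l r y * g r y.
Proof.
move=> /open_polytope_sub/PU Uy.
exact: (@tangency_algebra R (fun a b => M a b y) (fun b a => pderiv b (M b a) y)
  (f y) (l r y) (kk r y) (fun b => pderiv b f y) (n r) (fun b => V r b y)
  (fun b => B r b y) (fun b => pderiv b (B r b) y)
  (fun b => MV r b Uy) (fun b => dMB r b Uy) (Bn r Uy)).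
Qed.

Let dterm a b y : U y -> pderiv a (term a b) y =
  M a b y * pderiv a (pderiv b f) y + pderiv b f y * pderiv a (M a b) y
  - (f y * pderiv a (pderiv b (M b a)) y + pderiv b (M b a) y * pderiv a f y).
Proof.
move=> Uy.
have s1 := smooth_pderiv b sf; have s2 := smooth_pderiv b (sM b a).
have t1 : smooth_on_open U (fun y => M a b y * pderiv b f y).
  exact: (smoothM oU).
have t2 : smooth_on_open U (fun y => f y * pderiv b (M b a) y) by exact: (smoothM oU).
rewrite (pderivB a t1 t2 Uy) (pderivM a (sM a b) s1 Uy).
by rewrite (pderivM a sf s2 Uy).
Qed.

Definition pairing y := \sum_a \sum_b M a b y * pderiv a (pderiv b f) y.

Lemma smooth_pairing : smooth_on_open U pairing.
Proof.
apply: (smooth_sum oU) => i _; apply: (smooth_sum oU) => j _.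
by apply: (smoothM oU); [exact: sM|do 2!apply: smooth_pderiv].
Qed.

(** The difference of the integrands is the divergence of [X], which is tangent to the boundary with
    quotients [g]. *)
Lemma integral_pairing :
  \int[mu]_(y in Q) pairing y = \int[mu]_(y in Q) (f y * divdiv_conj y).
Proof.
have sfd : smooth_on_open U (fun y => f y * divdiv_conj y).
  by apply: (smoothM oU) => //; exact: smooth_divdiv_conj.
have mQ : measurable (Q : set RR) by apply: open_measurable2; exact: open_open_polytope.
have i1 := polytope_smooth_integrable cP PU smooth_pairing.
have i2 := polytope_smooth_integrable cP PU sfd.
apply/eqP; rewrite -subr_eq0 -RintegralB//; apply/eqP.
rewrite -[RHS](integral_divergence_tangent cP oU PU sX sg Xg).
apply: eq_Rintegral => y; rewrite inE => /open_polytope_sub/PU Uy.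
rewrite /X (pderivD 0 (sterm 0 0) (sterm 0 1) Uy) (pderivD 1 (sterm 1 0) (sterm 1 1) Uy).
rewrite !dterm//; apply: esym.
exact: (divergence_algebra (fun a b => M a b y) (fun a b => pderiv a (pderiv b f) y)
  (f y) (fun a => pderiv a f y) (fun d a b => pderiv d (M a b) y)
  (fun d e a b => pderiv d (pderiv e (M a b)) y)).
Qed.

End ByParts.

(** * Orthogonality *)

Section Vanishing.
Variable R : realType.
Notation RR := (measurableTypeR R * measurableTypeR R)%type.
Notation mu := (@leb2 R).

Definition open_square (y : R * R) (e : R) : set RR :=
  `]y.1 - e, y.1 + e[ `*` `]y.2 - e, y.2 + e[.

Lemma leb2_open_square_gt0 (y : R * R) (e : R) : 0 < e ->
  (0 < mu (open_square y e))%E.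
Proof.
move=> e0; rewrite /leb2 /open_square product_measure1E; [|exact: measurable_itv|exact: measurable_itv].
have E z : lebesgue_measure `]z - e, z + e[%classic = (e + e)%:E :> \bar R.
  by rewrite lebesgue_measure_itv/= lte_fin ifT; [rewrite -EFinD; congr EFin; ring|lra].
have e2 : 0 < (e + e) * (e + e) by rewrite mulr_gt0//; lra.
have -> : (lebesgue_measure `](y.1 - e)%R, (y.1 + e)%R[%classic *
  lebesgue_measure `](y.2 - e)%R, (y.2 + e)%R[%classic = ((e + e) * (e + e))%:E :> \bar R)%E.
  by rewrite !E.
by rewrite lte_fin.
Qed.

(** A positive value at one point persists on a small square by continuity, and that square would
    sit in a null set. *)
Lemma integral_eq0_open (O : set (R * R)) (f : R * R -> R) : open O ->
  (forall y, O y -> {for y, continuous f}) -> (forall y, O y -> 0 <= f y) ->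
  mu.-integrable (O : set RR) (EFin \o f) ->
  \int[mu]_(y in O) f y = 0 -> forall y, O y -> f y = 0.
Proof.
move=> oO cf f0 If intf y Oy; apply/eqP/negP => /negP fy0.
have mO := open_measurable2 oO.
have fy : 0 < f y by rewrite lt_neqAle eq_sym fy0 f0.
have Ef : (\int[mu]_(y in O) `|(f y)%:E| = 0)%E.
  transitivity ((\int[mu]_(y in O) (f y)%:E)%E).
    apply: eq_integral => z; rewrite inE => Oz.
    by rewrite gee0_abs// lee_fin f0.
  rewrite -(fineK (integrable_fin_num mO If)). exact: (congr1 (@EFin R) intf).
have [N [mN N0 subN]] := (ae_eq_integral_abs mu mO (measurable_int _ If)).1 Ef.
have nb : nbhs y (O `&` [set z | 0 < f z]).
  apply: filterI; first exact: open_nbhs_nbhs.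
  by have /cvgr_gt := cf _ Oy; apply.
have /nbhs_ballP[e /= e0 eO] := nb.
have BN : open_square y e `<=` N.
  move=> z [/=]; rewrite !in_itv/= => /andP[a1 b1] /andP[a2 b2].
  apply: subN => /=.
  have [Oz fz] : (O `&` [set z | 0 < f z]) z.
    by apply: eO; split; rewrite /ball/= ltr_norml; apply/andP; split; lra.
  by move=> /(_ Oz) [fz0]; move: fz; rewrite /= fz0 ltxx.
have := leb2_open_square_gt0 y e0; rewrite ltNge => /negP; apply.
rewrite -N0; apply: le_measure => //; rewrite inE//.
by apply: measurableX; exact: measurable_itv.
Qed.

End Vanishing.

(** Each function comes with its own neighbourhood and extension; after choosing them, a finite
    intersection serves all. *)
Lemma smooth_on_family (R : realType) (P : set (R * R)) (I : finType)
    (F : I -> R * R -> R) : (forall i, smooth_on P (F i)) ->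
  exists (U : set (R * R)) (g : I -> R * R -> R),
    [/\ open U, P `<=` U, forall i, smooth_on_open U (g i)
      & forall i y, P y -> F i y = g i y].
Proof.
move=> sF; have /choice[Ug HUg] : forall i, exists Ug : set (R * R) * (R * R -> R),
    [/\ open Ug.1, P `<=` Ug.1, smooth_on_open Ug.1 Ug.2
      & forall y, P y -> F i y = Ug.2 y].
  by move=> i; have [U [g H]] := sF i; exists (U, g).
exists [set y | forall i, (Ug i).1 y], (fun i => (Ug i).2); split.
- rewrite openE => y Hy; rewrite /interior /=.
  apply: (@filter_forall _ _ _ (nbhs y)) => i.
  by have [oU _ _ _] := HUg i; exact: open_nbhs_nbhs.
- by move=> y Py i; have [_ PU _ _] := HUg i; exact: PU.
- move=> i; have [_ _ sg _] := HUg i.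
  by apply: smooth_subset sg => y; exact.
- by move=> i y Py; have [_ _ _ E] := HUg i; exact: E.
Qed.

(** * The trace form Tr(h a h p) on 2x2 matrices *)

Section MatrixAlgebra.
Variable R : realType.
Implicit Types h a p : 'I_2 -> 'I_2 -> R.

Definition conj2 h a (i j : 'I_2) : R := \sum_s \sum_t h i s * a s t * h t j.

Definition trace2 h a p : R := \sum_i \sum_j conj2 h a i j * p j i.

Lemma complex_eqP (x y : R[i]) :
  complex.Re x = complex.Re y -> complex.Im x = complex.Im y -> x = y.
Proof. by case: x y => [a b] [a' b'] /= -> ->. Qed.

Lemma ReD (x y : R[i]) : complex.Re (x + y) = complex.Re x + complex.Re y.
Proof. by case: x y => [a b] [a' b']. Qed.

Lemma ImD (x y : R[i]) : complex.Im (x + y) = complex.Im x + complex.Im y.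
Proof. by case: x y => [a b] [a' b']. Qed.

Lemma ReM (x y : R[i]) : complex.Re (x * y) =
  complex.Re x * complex.Re y - complex.Im x * complex.Im y.
Proof. by case: x y => [a b] [a' b']. Qed.

Lemma ImM (x y : R[i]) : complex.Im (x * y) =
  complex.Re x * complex.Im y + complex.Im x * complex.Re y.
Proof. by case: x y => [a b] [a' b']. Qed.

Lemma conj_mx_entries (h a1 a2 : 'I_2 -> 'I_2 -> R) (Hm : 'M[R]_2)
    (Phi : 'M[R[i]]_2) i j :
  (forall i j, Hm i j = h i j) ->
  (forall i j, complex.Re (Phi i j) = a1 i j) ->
  (forall i j, complex.Im (Phi i j) = a2 i j) ->
  complex.Re ((mxC Hm *m Phi *m mxC Hm) i j) = conj2 h a1 i j /\
  complex.Im ((mxC Hm *m Phi *m mxC Hm) i j) = conj2 h a2 i j.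
Proof.
move=> HE E1 E2; rewrite /conj2 !mxE !sum_ord2 !mxE !sum_ord2 !mxE !HE.
rewrite !ReD !ImD !ReM !ImM !ReD !ImD !ReM !ImM /= !E1 !E2.
by split; ring.
Qed.

(** As h is real, the real bilinear form extends to complex arguments, and conjugating the second
    one fixes the signs. This reduces the L^2 product to real integrals. *)
Lemma trace_conj_mx (h a1 a2 p1 p2 : 'I_2 -> 'I_2 -> R) (Hm : 'M[R]_2)
    (Phi Psi : 'M[R[i]]_2) :
  (forall i j, Hm i j = h i j) ->
  (forall i j, complex.Re (Phi i j) = a1 i j) ->
  (forall i j, complex.Im (Phi i j) = a2 i j) ->
  (forall i j, complex.Re (Psi i j) = p1 i j) ->
  (forall i j, complex.Im (Psi i j) = p2 i j) ->
  let t := \tr (mxC Hm *m Phi *m mxC Hm *m conjmx2 Psi) in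
  complex.Re t = trace2 h a1 p1 + trace2 h a2 p2 /\
  complex.Im t = trace2 h a2 p1 - trace2 h a1 p2.
Proof.
move=> HE E1 E2 F1 F2 /=; rewrite /trace2 /mxtrace !sum_ord2.
have X i j := conj_mx_entries i j HE E1 E2.
set W := mxC Hm *m Phi *m mxC Hm in X *.
have Wr i j : complex.Re (W i j) = conj2 h a1 i j by have [] := X i j.
have Wi i j : complex.Im (W i j) = conj2 h a2 i j by have [] := X i j.
have G1 i j : complex.Re (conjmx2 Psi i j) = p1 i j.
  by rewrite mxE -F1; case: (Psi i j).
have G2 i j : complex.Im (conjmx2 Psi i j) = - p2 i j.
  by rewrite mxE -F2; case: (Psi i j).
rewrite ![(W *m _) _ _]mxE !sum_ord2 !ReD !ImD !ReM !ImM !Wr !Wi !G1 !G2.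
by split; ring.
Qed.

(* Cholesky: with h = L L^T, Tr(h a h a) is the sum of the squares of the entries
   of L^T a L. *)
Lemma trace2_sym_square (x y z a b d : R) : 0 < x ->
  (x * a + y * b) ^+ 2 + 2 * ((x * b + y * d) * (y * a + z * b)) + (y * b + z * d) ^+ 2
  = (x * a + 2 * y * b + y ^+ 2 * d / x) ^+ 2
    + 2 * (x * z - y * y) * (b + y * d / x) ^+ 2 + ((x * z - y * y) * d / x) ^+ 2.
Proof. by move=> x0; field; rewrite gt_eqF. Qed.

Section Positivity.
Variables h a : 'I_2 -> 'I_2 -> R.
Hypotheses (hsym : h 0 1 = h 1 0) (asym : a 0 1 = a 1 0).
Hypotheses (h0 : 0 < h 0 0) (hdet : 0 < h 0 0 * h 1 1 - h 0 1 * h 1 0).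

Let trace2E : trace2 h a a =
  (h 0 0 * a 0 0 + 2 * h 0 1 * a 0 1 + h 0 1 ^+ 2 * a 1 1 / h 0 0) ^+ 2
  + 2 * (h 0 0 * h 1 1 - h 0 1 * h 0 1) * (a 0 1 + h 0 1 * a 1 1 / h 0 0) ^+ 2
  + ((h 0 0 * h 1 1 - h 0 1 * h 0 1) * a 1 1 / h 0 0) ^+ 2.
Proof.
rewrite -trace2_sym_square// /trace2 /conj2 !sum_ord2 -hsym -asym; ring.
Qed.

Lemma trace2_ge0 : 0 <= trace2 h a a.
Proof.
have := hdet; rewrite trace2E -hsym => hd.
by rewrite !addr_ge0 ?sqr_ge0// mulr_ge0 ?sqr_ge0// mulr_ge0// ltW.
Qed.

(** All three squares vanish, and the entries follow by back substitution: [a 1 1] from the last,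
    [a 0 1] from the middle one, [a 0 0] from the first. *)
Lemma trace2_eq0 : trace2 h a a = 0 -> forall i j, a i j = 0.
Proof.
have := hdet; rewrite trace2E -hsym => hd /eqP.
have D0 : 0 <= 2 * (h 0 0 * h 1 1 - h 0 1 * h 0 1) * (a 0 1 + h 0 1 * a 1 1 / h 0 0) ^+ 2.
  by rewrite mulr_ge0 ?sqr_ge0// mulr_ge0// ltW.
rewrite paddr_eq0 ?sqr_ge0 ?addr_ge0 ?sqr_ge0//.
rewrite paddr_eq0 ?sqr_ge0// => /andP[/andP[/eqP e1 /eqP e2] /eqP e3].
have hn : h 0 0 != 0 by rewrite gt_eqF.
have dn : h 0 0 * h 1 1 - h 0 1 * h 0 1 != 0 by rewrite gt_eqF.
have a11 : a 1 1 = 0.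
  apply: (@mulfI _ ((h 0 0 * h 1 1 - h 0 1 * h 0 1) / h 0 0)).
    by rewrite mulf_neq0// invr_neq0.
  by rewrite mulr0 mulrAC; apply/eqP; rewrite -sqrf_eq0 e3.
rewrite a11 !(mulr0, mul0r, addr0) in e1 e2.
have a01 : a 0 1 = 0.
  apply/eqP; rewrite -sqrf_eq0; apply/eqP.
  apply: (@mulfI _ (2 * (h 0 0 * h 1 1 - h 0 1 * h 0 1))); last by rewrite mulr0.
  by rewrite mulf_neq0// pnatr_eq0.
rewrite a01 !(mulr0, addr0) in e1.
have a00 : a 0 0 = 0.
  apply: (@mulfI _ (h 0 0)) => //; rewrite mulr0.
  by apply/eqP; rewrite -sqrf_eq0 e1.
by apply: ord2P; apply: ord2P => //; rewrite -asym.
Qed.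

End Positivity.
End MatrixAlgebra.

(** * The moment map equation as orthogonality to Hessians *)

Section MomentMap.
Variables (R : realType) (N : nat) (nu : 'I_N -> int * int) (c : 'I_N -> R).
Notation P := (polytope nu c).
Notation Q := (open_polytope nu c).
Notation l := (ell nu c).
Notation n := (conormal R nu).
Notation RR := (measurableTypeR R * measurableTypeR R)%type.
Notation mu := (@leb2 R).
Hypotheses (cP : compact P) (PQ : P° = Q).
Variables (U : set (R * R)) (H : 'I_2 -> 'I_2 -> R * R -> R)
  (k : 'I_N -> 'I_2 -> R * R -> R) (G : R * R -> 'M[R]_2).
Hypotheses (oU : open U) (PU : P `<=` U).
Hypotheses (sH : forall a b, smooth_on_open U (H a b))
  (sk : forall r a, smooth_on_open U (k r a)).
Hypothesis Hsym : forall y a b, U y -> H a b y = H b a y.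
Hypothesis Hk : forall y r a, U y -> \sum_b H a b y * n r b = l r y * k r a y.
Hypothesis invG : forall y, Q y -> invmx (G y) = \matrix_(a, b) H a b y.
Variables (Phi : R * R -> 'M[R[i]]_2) (A1 A2 : 'I_2 -> 'I_2 -> R * R -> R).
Hypotheses (sA1 : forall a b, smooth_on_open U (A1 a b))
  (sA2 : forall a b, smooth_on_open U (A2 a b)).
Hypotheses (Phi1 : forall a b y, P y -> complex.Re (Phi y a b) = A1 a b y)
  (Phi2 : forall a b y, P y -> complex.Im (Phi y a b) = A2 a b y).

Let QP : Q `<=` P. Proof. exact: open_polytope_sub. Qed.
Let oQ : open Q. Proof. exact: open_open_polytope. Qed.
Let mQ : measurable (Q : set RR). Proof. exact: open_measurable2. Qed.

Let invGE y : Q y -> forall a b, invmx (G y) a b = H a b y.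
Proof. by move=> Qy a b; rewrite invG// mxE. Qed.

Let d1 := divdiv_conj H A1.
Let d2 := divdiv_conj H A2.

Let sd1 : smooth_on_open U d1. Proof. exact: smooth_divdiv_conj. Qed.
Let sd2 : smooth_on_open U d2. Proof. exact: smooth_divdiv_conj. Qed.

Lemma divdiv_congr (M : R * R -> 'M[R]_2) (F : 'I_2 -> 'I_2 -> R * R -> R) y :
  (forall z a b, Q z -> M z a b = F a b z) -> Q y ->
  divdiv M y = \sum_a \sum_b pderiv b (pderiv a (F a b)) y.
Proof.
move=> MF Qy; apply: eq_bigr => a _; apply: eq_bigr => b _.
apply: (pderiv_near b oQ Qy) => z Qz; apply: (pderiv_near a oQ Qz) => w Qw.
exact: MF.
Qed.

Lemma cdivdiv_xi y : Q y -> cdivdiv (xi_of G Phi) y = Complex (d1 y) (d2 y).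
Proof.
move=> Qy; apply: (congr2 (@Complex R) (divdiv_congr _ Qy) (divdiv_congr _ Qy)) =>
  z a b Qz; rewrite mxE.
  exact: (conj_mx_entries a b (invGE Qz) (fun i j => Phi1 i j (QP Qz))
    (fun i j => Phi2 i j (QP Qz))).1.
exact: (conj_mx_entries a b (invGE Qz) (fun i j => Phi1 i j (QP Qz))
    (fun i j => Phi2 i j (QP Qz))).2.
Qed.

Let h y a b := H a b y.
Let a1 y a b := A1 a b y.
Let a2 y a b := A2 a b y.

Lemma l2prodE (Psi : R * R -> 'M[R[i]]_2) (p1 p2 : R * R -> 'I_2 -> 'I_2 -> R) :
  (forall y a b, Q y -> complex.Re (Psi y a b) = p1 y a b) ->
  (forall y a b, Q y -> complex.Im (Psi y a b) = p2 y a b) ->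
  l2prod P G Phi Psi = Complex
    (\int[mu]_(y in Q) (trace2 (h y) (a1 y) (p1 y) + trace2 (h y) (a2 y) (p2 y)))
    (\int[mu]_(y in Q) (trace2 (h y) (a2 y) (p1 y) - trace2 (h y) (a1 y) (p2 y))).
Proof.
move=> E1 E2; rewrite /l2prod PQ.
have X y (Qy : Q y) := trace_conj_mx (invGE Qy) (fun i j => Phi1 i j (QP Qy))
  (fun i j => Phi2 i j (QP Qy)) (fun i j => E1 y i j Qy) (fun i j => E2 y i j Qy).
congr Complex; apply: eq_Rintegral => y; rewrite inE => Qy.
  exact: (X y Qy).1.
exact: (X y Qy).2.
Qed.

(** [f] is arbitrary off [P], but its Hessian at a point of the open set [Q] only sees values in
    [Q], where [f] agrees with the smooth extensions. *)
Lemma chess_extension (f : R * R -> R[i]) : csmooth_on P f ->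
  exists V f1 f2, [/\ open V, P `<=` V, V `<=` U,
    smooth_on_open V f1 /\ smooth_on_open V f2 &
    forall y, Q y -> [/\ complex.Re (f y) = f1 y, complex.Im (f y) = f2 y,
      forall a b, complex.Re (chess f y a b) = pderiv b (pderiv a f1) y &
      forall a b, complex.Im (chess f y a b) = pderiv b (pderiv a f2) y]].
Proof.
move=> [[U1 [f1 [oU1 PU1 sf1 f1E]]] [U2 [f2 [oU2 PU2 sf2 f2E]]]].
exists (U `&` U1 `&` U2), f1, f2; split.
- by apply: openI => //; exact: openI.
- by move=> y Py; split; [split; [exact: PU|exact: PU1]|exact: PU2].
- by move=> y [[]].
- by split; [apply: smooth_subset sf1|apply: smooth_subset sf2] => y [[]].
move=> y Qy; split; [exact/f1E/QP|exact/f2E/QP| |] => a b.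
  apply: (etrans (congr1 (@complex.Re R) (mxE _ _ _ _))); apply: (etrans (hessE _ _ _ _)).
  apply: (pderiv_near b oQ Qy) => z Qz; apply: (pderiv_near a oQ Qz) => w Qw.
  exact/f1E/QP.
apply: (etrans (congr1 (@complex.Im R) (mxE _ _ _ _))); apply: (etrans (hessE _ _ _ _)).
apply: (pderiv_near b oQ Qy) => z Qz; apply: (pderiv_near a oQ Qz) => w Qw.
exact/f2E/QP.
Qed.

Lemma l2prod_chess (f : R * R -> R[i]) : csmooth_on P f ->
  l2prod P G Phi (chess f) = Complex
    (\int[mu]_(y in Q) (complex.Re (f y) * d1 y) + \int[mu]_(y in Q) (complex.Im (f y) * d2 y))
    (\int[mu]_(y in Q) (complex.Re (f y) * d2 y) - \int[mu]_(y in Q) (complex.Im (f y) * d1 y)).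
Proof.
move=> /chess_extension[V [f1 [f2 [oV PV VU [sf1 sf2] fE]]]].
have sub g : smooth_on_open U g -> smooth_on_open V g by exact: smooth_subset.
have sHV a b := sub _ (sH a b).
have s1 a b := sub _ (sA1 a b).
have s2 a b := sub _ (sA2 a b).
have skV r a := sub _ (sk r a).
have HsymV y a b (Vy : V y) := Hsym a b (VU _ Vy).
have HkV y r a (Vy : V y) := Hk r a (VU _ Vy).
have I1 := integral_pairing cP oV PV sHV s1 skV HsymV HkV.
have I2 := integral_pairing cP oV PV sHV s2 skV HsymV HkV.
have S1 g (sg : smooth_on_open V g) :=
  polytope_smooth_integrable cP PV (smooth_pairing oV sHV s1 sg).
have S2 g (sg : smooth_on_open V g) :=
  polytope_smooth_integrable cP PV (smooth_pairing oV sHV s2 sg).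
rewrite (@l2prodE _ (fun y a b => pderiv b (pderiv a f1) y)
  (fun y a b => pderiv b (pderiv a f2) y)); first last.
- by move=> y a b /fE[].
- by move=> y a b /fE[].
have R1 (d : R * R -> R) : \int[mu]_(y in Q) (complex.Re (f y) * d y) =
    \int[mu]_(y in Q) (f1 y * d y).
  by apply: eq_Rintegral => y; rewrite inE => /fE[-> _ _ _].
have R2 (d : R * R -> R) : \int[mu]_(y in Q) (complex.Im (f y) * d y) =
    \int[mu]_(y in Q) (f2 y * d y).
  by apply: eq_Rintegral => y; rewrite inE => /fE[_ -> _ _].
congr Complex.
  apply: (etrans (RintegralD mQ (S1 _ sf1) (S2 _ sf2))).
  (* The trace against a Hessian is [pairing] by definition, so integration by parts applies to each
     real component. *)
  exact: (congr2 (fun s t : R => s + t) (etrans (I1 _ sf1) (esym (R1 d1)))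
    (etrans (I2 _ sf2) (esym (R2 d2)))).
apply: (etrans (RintegralB mQ (S2 _ sf1) (S1 _ sf2))).
exact: (congr2 (fun s t : R => s - t) (etrans (I2 _ sf1) (esym (R1 d2)))
  (etrans (I1 _ sf2) (esym (R2 d1)))).
Qed.

Let integral0 (F : R * R -> R) : (forall y, Q y -> F y = 0) -> \int[mu]_(y in Q) F y = 0.
Proof.
move=> F0; rewrite (@eq_Rintegral _ _ _ mu Q (fun=> 0)).
  by rewrite (Rintegral_cst mu mQ) mul0r.
by move=> y; rewrite inE; exact: F0.
Qed.

Let csmooth_real g : smooth_on_open U g -> csmooth_on P (fun y => Complex (g y) 0).
Proof.
move=> sg; split; [exists U, g|exists U, (fun=> 0)]; split => //.
exact: smooth_cst.
Qed.

Let square_eq0 g : smooth_on_open U g -> \int[mu]_(y in Q) (g y * g y) = 0 ->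
  forall y, Q y -> g y = 0.
Proof.
move=> sg intg y Qy.
have sgg : smooth_on_open U (fun y => g y * g y) by exact: smoothM.
have : g y * g y = 0.
  apply: (integral_eq0_open oQ _ _ _ intg Qy).
  - by move=> z /QP/PU Uz; exact: (smooth_continuous sgg Uz).
  - by move=> z _; rewrite -expr2 sqr_ge0.
  - exact: (polytope_smooth_integrable cP PU sgg).
by move=> /eqP; rewrite mulf_eq0 orbb => /eqP.
Qed.

Lemma moment_map_orthogonal : complex_moment_map_eq P (xi_of G Phi) <->
  forall f, csmooth_on P f -> l2prod P G Phi (chess f) = 0.
Proof.
split.
  rewrite /complex_moment_map_eq PQ => mm f sf; rewrite l2prod_chess//.
  have d10 y : Q y -> d1 y = 0.
    by move=> Qy; exact: (congr1 (@complex.Re R) (etrans (esym (cdivdiv_xi Qy)) (mm y Qy))).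
  have d20 y : Q y -> d2 y = 0.
    by move=> Qy; exact: (congr1 (@complex.Im R) (etrans (esym (cdivdiv_xi Qy)) (mm y Qy))).
  have Z g d : (forall y, Q y -> d y = 0) -> \int[mu]_(y in Q) (g y * d y) = 0.
    by move=> d0; apply: integral0 => y Qy; rewrite d0// mulr0.
  apply: complex_eqP.
    exact: (etrans (congr2 (fun s t : R => s + t) (Z _ _ d10) (Z _ _ d20)) (addr0 0)).
  exact: (etrans (congr2 (fun s t : R => s - t) (Z _ _ d20) (Z _ _ d10)) (subr0 0)).
move=> orth y; rewrite PQ => Qy; rewrite cdivdiv_xi//.
(* Real test functions suffice: f = d1 makes the real part the integral of d1^2, and f = d2 makes
   the imaginary part that of d2^2. *)
have [E1 _] : Complex _ _ = Complex 0 0 := etrans (esym (l2prod_chess (csmooth_real sd1)))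
  (orth _ (csmooth_real sd1)).
have [_ E2] : Complex _ _ = Complex 0 0 := etrans (esym (l2prod_chess (csmooth_real sd2)))
  (orth _ (csmooth_real sd2)).
have Z d : \int[mu]_(y in Q) (0 * d y) = 0.
  by apply: integral0 => z _; rewrite mul0r.
have F1 : \int[mu]_(y in Q) (d1 y * d1 y) = 0.
  exact: (etrans (esym (etrans (congr1 (GRing.add _) (Z d2)) (addr0 _))) E1).
have F2 : \int[mu]_(y in Q) (d2 y * d2 y) = 0.
  exact: (etrans (esym (etrans (congr1 (fun t : R => _ - t) (Z d1)) (subr0 _))) E2).
by rewrite (square_eq0 sd1 F1 Qy) (square_eq0 sd2 F2 Qy).
Qed.

Hypothesis Hpos : forall y, Q y ->
  0 < H 0 0 y /\ 0 < H 0 0 y * H 1 1 y - H 0 1 y * H 1 0 y.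
Hypothesis Phisym : forall y, P y -> (Phi y)^T = Phi y.

(** The real part of the product of [Phi] with itself integrates two nonnegative continuous traces,
    so both vanish pointwise. [Psi] will be a Hessian, which is compared with [Phi] on the interior
    only. *)
Lemma self_orthogonal_eq0 (Psi : R * R -> 'M[R[i]]_2) :
  (forall y, Q y -> Psi y = Phi y) -> l2prod P G Phi Psi = 0 ->
  forall y, Q y -> Phi y = 0.
Proof.
move=> PsiE; rewrite (@l2prodE _ a1 a2); first last.
- by move=> y a b Qy; rewrite PsiE// Phi2//; exact: QP.
- by move=> y a b Qy; rewrite PsiE// Phi1//; exact: QP.
move=> [E _] y Qy.
have as1 z : Q z -> a1 z 0 1 = a1 z 1 0.
  move=> Qz; rewrite /a1 -(Phi1 0 1 (QP Qz)) -(Phi1 1 0 (QP Qz)).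
  by have := congr1 (fun M : 'M[R[i]]_2 => complex.Re (M 1 0)) (Phisym (QP Qz)); rewrite mxE.
have as2 z : Q z -> a2 z 0 1 = a2 z 1 0.
  move=> Qz; rewrite /a2 -(Phi2 0 1 (QP Qz)) -(Phi2 1 0 (QP Qz)).
  by have := congr1 (fun M : 'M[R[i]]_2 => complex.Im (M 1 0)) (Phisym (QP Qz)); rewrite mxE.
have hs z : Q z -> h z 0 1 = h z 1 0 by move=> /QP/PU; exact: Hsym.
have ge1 z (Qz : Q z) := trace2_ge0 (hs z Qz) (as1 z Qz) (Hpos Qz).1 (Hpos Qz).2.
have ge2 z (Qz : Q z) := trace2_ge0 (hs z Qz) (as2 z Qz) (Hpos Qz).1 (Hpos Qz).2.
have sS : smooth_on_open U (fun y => trace2 (h y) (a1 y) (a1 y) + trace2 (h y) (a2 y) (a2 y)).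
  apply: (smoothD oU); apply: (smooth_sum oU) => a _; apply: (smooth_sum oU) => b _.
    exact: (smoothM oU (smooth_conj_by oU sH sA1 a b) (sA1 b a)).
  exact: (smoothM oU (smooth_conj_by oU sH sA2 a b) (sA2 b a)).
have S0 : trace2 (h y) (a1 y) (a1 y) + trace2 (h y) (a2 y) (a2 y) = 0.
  apply: (integral_eq0_open oQ _ _ _ E Qy).
  - by move=> z /QP/PU Uz; exact: (smooth_continuous sS Uz).
  - by move=> z Qz; rewrite addr_ge0// ?ge1 ?ge2.
  - exact: (polytope_smooth_integrable cP PU sS).
move/eqP: S0; rewrite paddr_eq0 ?ge1 ?ge2// => /andP[/eqP z1 /eqP z2].
apply/matrixP => a b; rewrite [RHS]mxE; apply: complex_eqP.
  rewrite Phi1; last exact: QP.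
  exact: (trace2_eq0 (hs y Qy) (as1 y Qy) (Hpos Qy).1 (Hpos Qy).2 z1 a b).
rewrite Phi2; last exact: QP.
exact: (trace2_eq0 (hs y Qy) (as2 y Qy) (Hpos Qy).1 (Hpos Qy).2 z2 a b).
Qed.

End MomentMap.

(** * Orthogonality and integrability for symplectic potentials on Delzant polytopes *)

Theorem corollary4p2p4 (R : realType) (N : nat) (nu : 'I_N -> int * int)
    (c : 'I_N -> R) (u : R * R -> R) (Phi : R * R -> 'M[complex R]_2) :
  let P := polytope nu c in
  let G := hess u in
  let xi := xi_of G Phi in
  delzant nu c ->
  symplectic_potential nu c u ->
  (forall y, P y -> (Phi y)^T = Phi y) ->
  (forall a b, csmooth_on P (fun y => Phi y a b)) ->
  (complex_moment_map_eq P xi <->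
     forall f : R * R -> complex R, csmooth_on P f ->
       l2prod P G Phi (chess f) = 0) /\
  (HcscK P G xi ->
     (integrable_deformation P G xi <-> forall y, P° y -> xi y = 0)).
Proof.
move=> P G xi dz sp Phisym sPhi.
have [U [H [k [oU PU [sH sk] [Hsym Hk] HG]]]] := inverse_hessian dz sp.
have [cP _ _ coP _] := dz; have PQ := interior_polytope c coP.
have [U1 [A1 [oU1 PU1 sA1 A1E]]] := smooth_on_family (fun ab => (sPhi ab.1 ab.2).1).
have [U2 [A2 [oU2 PU2 sA2 A2E]]] := smooth_on_family (fun ab => (sPhi ab.1 ab.2).2).
(* A common neighbourhood of [P] for the inverse Hessian and for the real and imaginary parts of all
   entries of [Phi]. *)
pose V := U `&` U1 `&` U2.
have oV : open V by apply: openI => //; exact: openI.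
have PV : polytope nu c `<=` V.
  by move=> y Py; split; [split; [exact: PU|exact: PU1]|exact: PU2].
have VU : V `<=` U by move=> y [[]].
have VU1 : V `<=` U1 by move=> y [[]].
have VU2 : V `<=` U2 by move=> y [].
have sHV a b : smooth_on_open V (H a b) by exact: smooth_subset (sH a b).
have skV r a : smooth_on_open V (k r a) by exact: smooth_subset (sk r a).
have s1 a b : smooth_on_open V (A1 (a, b)) by exact: smooth_subset (sA1 (a, b)).
have s2 a b : smooth_on_open V (A2 (a, b)) by exact: smooth_subset (sA2 (a, b)).
have HsymV y a b (Vy : V y) := Hsym y a b (VU _ Vy).
have HkV y r a (Vy : V y) := Hk y r a (VU _ Vy).
have invG y : open_polytope nu c y -> invmx (G y) = \matrix_(a, b) H a b y.
  by move=> /HG[].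
have P1 a b y (Py : polytope nu c y) := A1E (a, b) y Py.
have P2 a b y (Py : polytope nu c y) := A2E (a, b) y Py.
have part1 := moment_map_orthogonal cP PQ oV PV sHV skV HsymV HkV invG s1 s2 P1 P2.
split; first exact: part1.
move=> [_ mm _]; rewrite PQ.
have unitG y : open_polytope nu c y -> mxC (G y) *m mxC (invmx (G y)) = 1%:M /\
    mxC (invmx (G y)) *m mxC (G y) = 1%:M.
  by move=> /HG[uG _ _ _]; rewrite -!map_mxM mulmxV// mulVmx// map_mx1.
split=> [[f sf fE]|xi0].
  (* G xi G equals [Phi], so integrability says that [Phi] is itself one of the Hessians to which it
     is orthogonal. *)
  have Psi y : open_polytope nu c y -> chess f y = Phi y.
    move=> Qy; rewrite -fE ?PQ// /xi /xi_of.
    by rewrite !mulmxA (unitG y Qy).1 mul1mx -mulmxA (unitG y Qy).2 mulmx1.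
  have Hpos y : open_polytope nu c y ->
      0 < H 0 0 y /\ 0 < H 0 0 y * H 1 1 y - H 0 1 y * H 1 0 y.
    by move=> /HG[].
  move=> y Qy; rewrite /xi /xi_of.
  rewrite (self_orthogonal_eq0 cP PQ oV PV sHV HsymV invG s1 s2 P1 P2 Hpos Phisym Psi
    (part1.1 mm f sf) Qy).
  by rewrite mulmx0 mul0mx.
(* Conversely, xi = 0 is the deformation given by the Hessian of the zero function. *)
exists (fun=> 0); first by split; exists setT, (fun=> 0); split => //;
  [exact: openT|exact: smooth_cst openT _|exact: openT|exact: smooth_cst openT _].
move=> y; rewrite PQ => Qy; rewrite xi0// mulmx0 mul0mx.
apply/esym/matrixP => a b; rewrite [RHS]mxE; apply: complex_eqP.
  apply: (etrans (congr1 (@complex.Re R) (mxE _ _ _ _))); apply: (etrans (hessE _ _ _ _)).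
  rewrite (_ : pderiv a _ = fun=> 0); first exact: pderiv_cst.
  by apply/funext => z; exact: pderiv_cst.
apply: (etrans (congr1 (@complex.Im R) (mxE _ _ _ _))); apply: (etrans (hessE _ _ _ _)).
rewrite (_ : pderiv a _ = fun=> 0); first exact: pderiv_cst.
by apply/funext => z; exact: pderiv_cst.
Qed.
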